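(* For every integer $n\ge 1$, the theory $\mathrm{Univ}_n$ is complete. Consequently, $T_n=\mathrm{Th}(\mathfrak M_n)$ is decidable and pseudofinite (every sentence of $T_n$ has a finite model).
   Context: Graphs are structures in the language $\mathcal L=\{R\}$ with $R$ a symmetric irreflexive binary relation; substructures are induced subgraphs. For a finite graph $A$ let $\delta(A)=|A|-e(A)$, where $e(A)$ is the number of edges. Let $\mathcal K_\omega$ be the class of finite graphs $A$ with $\delta(B)>0$ for all nonempty $B\subseteq A$ (the finite forests). For $n\ge1$, $\mathcal K_n$ is the class of members of $\mathcal K_\omega$ (including the empty graph) satisfying the sentence $\theta_n$: $\forall x\big[\deg(x)\ge n+2\to\neg\exists y_1\dots y_{2n}\big(R(x,y_1)\wedge\bigwedge_{1\le i<j\le 2n}y_i\neq y_j\wedge\bigwedge_{i=2}^{2n}R(y_{i-1},y_i)\big)\big]$. For finite $A\subseteq B$, $A\le^*B$ means $\delta(C)>\delta(A)$ whenever $A\subsetneq C\subseteq B$; for a possibly infinite graph $M$ and finite $A\subseteq M$, $A\le^*M$ means $A\le^*B$ for all finite $B$ with $A\subseteq B\subseteq M$. A closed embedding $f:B\to M$ is an isomorphism onto an induced subgraph $f(B)$ with $f(B)\le^*M$. $\mathfrak M_n$ is the unique countable graph whose finite induced subgraphs all lie in $\mathcal K_n$ and which satisfies: every $A\in\mathcal K_n$ has a closed embedding into $\mathfrak M_n$; whenever $A\le^*B\in\mathcal K_n$ and $A\le^*\mathfrak M_n$ there is a closed embedding of $B$ into $\mathfrak M_n$ fixing $A$ pointwise;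 and $\mathfrak M_n$ is the union of a chain $A_0\le^*A_1\le^*\cdots$ of members of $\mathcal K_n$. For $m\in\omega$ let $\gamma^*_m(x_1,\dots,x_m)$ be the formula $\forall y\big(\bigwedge_{i=1}^m y\neq x_i\to\bigwedge_{i=1}^m\neg R(x_i,y)\big)$, and for a finite graph $A=\{a_1,\dots,a_m\}$ let $\mathrm{diag}_A(\bar x)$ be the conjunction of all atomic and negated atomic formulas (including equalities and inequalities) true of $(a_1,\dots,a_m)$ in $A$. $\mathrm{Univ}_n$ is the set of sentences consisting of: the axioms saying $R$ is symmetric and irreflexive and there are no cycles (for each $k\ge3$, no cycle of length $k$); the sentence $\theta_n$; and, for each $A\in\mathcal K_n$ with $|A|=m$, the sentence $\exists\bar x\,(\mathrm{diag}_A(\bar x)\wedge\gamma^*_m(\bar x))$. *)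

(* Defs.v *)
From HB Require Import structures.
From mathcomp Require Import all_boot all_order all_algebra finmap.

Set Implicit Arguments.
Unset Strict Implicit.
Unset Printing Implicit Defensive.

Import Order.TTheory GRing.Theory Num.Theory.
Local Open Scope fset_scope.

Record structure := Structure { carrier :> Type; rel_of : carrier -> carrier -> Prop }.

(* [formula k]: formulas with free variables among k variables, in de Bruijn
   style: a quantifier binds variable [ord0] of its body, and variable [i] of
   the context becomes [lift ord0 i] there.  Hence [formula 0] is the type of
   sentences, and satisfaction makes sense in the empty structure as well. *)
Inductive formula : nat -> Type :=
| FEq  k : 'I_k -> 'I_k -> formula k
| FRel k : 'I_k -> 'I_k -> formula k
| FBot k : formula k
| FImp k : formula k -> formula k -> formula k
| FAnd k : formula k -> formula k -> formula k
| FOr  k : formula k -> formula k -> formula k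
| FAll k : formula k.+1 -> formula k
| FEx  k : formula k.+1 -> formula k.

Arguments FBot {k}.

Notation sentence := (formula 0).

Definition FNot k (p : formula k) : formula k := FImp p FBot.
Definition FTop {k} : formula k := FNot FBot.

Definition env_cons (M : Type) k (a : M) (v : 'I_k -> M) : 'I_k.+1 -> M :=
  fun i => if unlift ord0 i is Some j then v j else a.

Fixpoint sat (M : structure) k (p : formula k) : ('I_k -> M) -> Prop :=
  match p in formula k return ('I_k -> M) -> Prop with
  | FEq _ i j  => fun v => v i = v j
  | FRel _ i j => fun v => rel_of (v i) (v j)
  | FBot _     => fun _ => False
  | FImp _ p q => fun v => sat p v -> sat q v
  | FAnd _ p q => fun v => sat p v /\ sat q v
  | FOr _ p q  => fun v => sat p v \/ sat q v
  | FAll _ p   => fun v => forall a : M, sat p (env_cons a v)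
  | FEx _ p    => fun v => exists a : M, sat p (env_cons a v)
  end.

Definition no_var (M : Type) (i : 'I_0) : M := match notF (valP i) with end.

Definition models (M : structure) (p : sentence) : Prop := sat p (no_var M).

Definition theory := sentence -> Prop.

Definition is_model (M : structure) (T : theory) : Prop :=
  forall p, T p -> models M p.

Definition entails (T : theory) (p : sentence) : Prop :=
  forall M : structure, is_model M T -> models M p.

Definition Th (M : structure) : theory := models M.

Definition complete (T : theory) : Prop :=
  (exists M : structure, is_model M T) /\
  (forall p : sentence, entails T p \/ entails T (FNot p)).

Definition pseudofinite (T : theory) : Prop :=
  forall p, T p ->
    exists (V : finType) (E : V -> V -> Prop),
      0 < #|V| /\ models (Structure E) p.

(* The general recursive functions: the least class of total functions
   containing zero, successor and projections, and closed under composition,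
   primitive recursion and minimization of regular functions. *)
Inductive recursive : forall k, (k.-tuple nat -> nat) -> Prop :=
| rec_zero : recursive (fun _ : 0.-tuple nat => 0)
| rec_succ : recursive (fun v : 1.-tuple nat => (thead v).+1)
| rec_proj k (i : 'I_k) : recursive (fun v : k.-tuple nat => tnth v i)
| rec_comp k m (g : m.-tuple nat -> nat) (h : 'I_m -> k.-tuple nat -> nat) :
    recursive g -> (forall i, recursive (h i)) ->
    recursive (fun v => g [tuple h i v | i < m])
| rec_prim k (g : k.-tuple nat -> nat) (h : k.+2.-tuple nat -> nat)
    (f : k.+1.-tuple nat -> nat) :
    recursive g -> recursive h ->
    (forall v, f (cons_tuple 0 v) = g v) ->
    (forall n v, f (cons_tuple n.+1 v) =
                 h (cons_tuple n (cons_tuple (f (cons_tuple n v)) v))) ->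
    recursive f
| rec_min k (g : k.+1.-tuple nat -> nat) (f : k.-tuple nat -> nat) :
    recursive g ->
    (forall v, g (cons_tuple (f v) v) = 0) ->
    (forall v n, n < f v -> g (cons_tuple n v) <> 0) ->
    recursive f.

(* Goedel numbers; [CodeSeq.code] is a bijection from [seq nat] to [nat]. *)
Fixpoint goedel k (p : formula k) : nat :=
  match p with
  | FEq _ i j  => CodeSeq.code [:: 0; val i; val j]
  | FRel _ i j => CodeSeq.code [:: 1; val i; val j]
  | FBot _     => CodeSeq.code [:: 2]
  | FImp _ p q => CodeSeq.code [:: 3; goedel p; goedel q]
  | FAnd _ p q => CodeSeq.code [:: 4; goedel p; goedel q]
  | FOr _ p q  => CodeSeq.code [:: 5; goedel p; goedel q]
  | FAll _ p   => CodeSeq.code [:: 6; goedel p]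
  | FEx _ p    => CodeSeq.code [:: 7; goedel p]
  end.

Definition decidable_theory (T : theory) : Prop :=
  exists f : 1.-tuple nat -> nat, recursive f /\
    forall p : sentence, f [tuple goedel p] = 1 <-> entails T p.

Record graph := Graph {
  vertex :> choiceType;
  adj : rel vertex;
  adj_sym : symmetric adj;
  adj_irr : irreflexive adj }.

Record fgraph := FGraph {
  fvertex :> finType;
  fadj : rel fvertex;
  fadj_sym : symmetric fadj;
  fadj_irr : irreflexive fadj }.

Definition graph_of_fgraph (A : fgraph) : graph :=
  Graph (@fadj_sym A) (@fadj_irr A).
Coercion graph_of_fgraph : fgraph >-> graph.

Definition structure_of_graph (G : graph) : structure :=
  Structure (fun x y : G => adj x y).
Coercion structure_of_graph : graph >-> structure.

Definition induced_adj (G : graph) (A : {fset G}) : rel A :=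
  fun x y => adj (val x) (val y).

Fact induced_sym (G : graph) (A : {fset G}) : symmetric (@induced_adj G A).
Proof. by move=> x y; apply: adj_sym. Qed.

Fact induced_irr (G : graph) (A : {fset G}) : irreflexive (@induced_adj G A).
Proof. by move=> x; apply: adj_irr. Qed.

Definition induced (G : graph) (A : {fset G}) : fgraph :=
  FGraph (@induced_sym G A) (@induced_irr G A).

Definition edges (A : fgraph) : {set {set A}} :=
  [set [set p.1; p.2] | p : A * A & fadj p.1 p.2].

Definition delta (A : fgraph) : int := (#|A|%:Z - #|edges A|%:Z)%R.

(* A <=* B for finite subsets of an ambient graph *)
Definition le_star (G : graph) (A B : {fset G}) : Prop :=
  A `<=` B /\
  forall C : {fset G}, A `<` C -> C `<=` B ->
    (delta (induced A) < delta (induced C))%R.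

(* A <=* G; for a finite graph G this is [le_star] of A in the whole of G. *)
Definition closed_in (G : graph) (A : {fset G}) : Prop :=
  forall B : {fset G}, A `<=` B -> le_star A B.

Definition closed_embedding (B : fgraph) (G : graph) (f : B -> G) : Prop :=
  [/\ injective f,
      forall x y, adj (f x) (f y) = fadj x y
    & closed_in [fset f x | x : B]].

Notation "\AND_ ( i < m | P ) F" := (\big[@FAnd _/FTop]_(i < m | P) F)
  (at level 41, F at level 41, i, m at level 50).
Notation "\AND_ ( i < m ) F" := (\big[@FAnd _/FTop]_(i < m) F)
  (at level 41, F at level 41, i, m at level 50).

(* existential closure over the first m variables; in the body the quantified
   variables are [lshift k i] and the remaining ones are [rshift m j] *)
Fixpoint exs k m : formula (m + k) -> formula k :=
  match m return formula (m + k) -> formula k with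
  | 0 => id
  | m'.+1 => fun p => @exs k m' (FEx p)
  end.

Definition distinct k m (y : 'I_m -> 'I_k) : formula k :=
  \AND_(i < m) \AND_(j < m | i < j) FNot (FEq (y i) (y j)).

(* path y_0 - y_1 - ... - y_(m-1) *)
Definition walk k m (y : 'I_m -> 'I_k) : formula k :=
  \AND_(i < m) \AND_(j < m | j == i.+1 :> nat) FRel (y i) (y j).

Definition sym_ax : sentence :=
  FAll (FAll (FImp (FRel (lift ord0 ord0) ord0) (FRel ord0 (lift ord0 ord0)))).

Definition irr_ax : sentence := FAll (FNot (FRel ord0 ord0)).

(* [ordS i] is the cyclic successor of i *)
Definition no_cycle (k : nat) : sentence :=
  let y := lshift 0 : 'I_k -> 'I_(k + 0) in
  FNot (exs (FAnd (distinct y) (\AND_(i < k) FRel (y i) (y (ordS i))))).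

Definition deg_ge (d : nat) : formula 1 :=
  let x := rshift d ord0 : 'I_(d + 1) in
  let z := lshift 1 : 'I_d -> 'I_(d + 1) in
  exs (FAnd (distinct z) (\AND_(i < d) FRel x (z i))).

(* The y's are pairwise distinct but need not differ from x. *)
Definition theta (n : nat) : sentence :=
  let m := (2 * n)%N in
  let x := rshift m ord0 : 'I_(m + 1) in
  let y := lshift 1 : 'I_m -> 'I_(m + 1) in
  FAll (FImp (deg_ge n.+2)
    (FNot (exs (FAnd (\AND_(i < m | i == 0 :> nat) FRel x (y i))
                     (FAnd (distinct y) (walk y)))))).

Definition gamma_star k m (x : 'I_m -> 'I_k) : formula k :=
  FAll (FImp (\AND_(i < m) FNot (FEq ord0 (lift ord0 (x i))))
             (\AND_(i < m) FNot (FRel (lift ord0 (x i)) ord0))).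

Definition literal k (b : bool) (p : formula k) : formula k :=
  if b then p else FNot p.

Definition diag (A : fgraph) k (x : 'I_#|A| -> 'I_k) : formula k :=
  \AND_(i < #|A|) \AND_(j < #|A|)
    FAnd (literal (enum_val i == enum_val j :> A) (FEq (x i) (x j)))
         (literal (fadj (enum_val i : A) (enum_val j)) (FRel (x i) (x j))).

Definition K_omega (A : fgraph) : Prop :=
  forall B : {fset A}, B != fset0 -> (0 < delta (@induced A B))%R.

Definition K (n : nat) (A : fgraph) : Prop := K_omega A /\ models A (theta n).

Inductive Univ (n : nat) : theory :=
| Univ_sym : Univ n sym_ax
| Univ_irr : Univ n irr_ax
| Univ_acyclic k : 3 <= k -> Univ n (no_cycle k)
| Univ_theta : Univ n (theta n)
| Univ_component (A : fgraph) : K n A ->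
    let x := lshift 0 : 'I_#|A| -> 'I_(#|A| + 0) in
    Univ n (exs (FAnd (diag x) (gamma_star x))).

(* [is_M n M]: M has the properties characterising the graph M_n up to
   isomorphism. *)
Record is_M (n : nat) (M : graph) : Prop := {
  is_M_countable : exists f : M -> nat, injective f;
  is_M_age : forall A : {fset M}, K n (induced A);
  is_M_universal : forall A : fgraph, K n A ->
    exists f : A -> M, closed_embedding f;
  (* "A <=* M" and "fixing A pointwise" are relative to the inclusion of A
     into M, given here as a closed embedding g *)
  is_M_extension : forall (B : fgraph) (A : {fset B}), K n B ->
    @closed_in B A ->
    forall g : @induced B A -> M, closed_embedding g ->
    exists f : B -> M, closed_embedding f /\ forall a : A, f (val a) = g a;
  is_M_chain : exists A : nat -> {fset M},
    [/\ forall i, K n (induced (A i)),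
        forall i, le_star (A i) (A i.+1)
      & forall x : M, exists i, x \in A i] }.

(* Main.v *)
Require Import Defs.
From mathcomp Require Import all_boot all_order all_algebra finmap.
From mathcomp Require Import boolp zify.

(* In a forest a finite subset is closed exactly when no edge leaves it, so a
   model of Univ_n is a forest satisfying theta_n in which every A in K_n occurs
   as a union of components ("rich" below); conversely M_n has these properties,
   and so does, up to a given size of A, a finite graph: the disjoint union of
   all forests of K_n on s labelled vertices.

   Two such graphs agree on sentences of quantifier rank q as soon as both are
   rich up to a size computable from q.  With k rounds of the
   Ehrenfeucht-Fraisse game left one maintains the equivalence, for 2 * 4^k
   rounds, of the balls of radius 4^k around the chosen points.  A move close to
   the chosen points is answered inside these balls.  A distant move x is
   answered in an untouched finite component: the ball around x is a tree of
   bounded depth, hence equivalent to a finite subtree of bounded size, obtained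
   by keeping at each vertex only boundedly many branches of each type.

   Completeness and pseudofiniteness follow at once, and T_n is decided by
   evaluating sentences in the finite graph, whose adjacency is recursive. *)

Set Implicit Arguments.
Unset Strict Implicit.
Unset Printing Implicit Defensive.

Local Open Scope fset_scope.
Local Open Scope nat_scope.

(** * Semantics of the axioms *)

(** The models compared are arbitrary and may have infinite components, whereas the reply to a
    distant move has to be found in a component supplied by richness, finite and of size bounded in
    advance. This forces the pruning, with a bound that depends on the numbers of rounds and the
    radius only.

    The constants come from one move, with [r = 4 ^ k]. If the new point is within [2 * r + 1] of a
    chosen one, its [r]-ball lies inside the old [4 * r]-balls, as [3 * r + 1 <= 4 * r]; otherwise
    its [r]-ball neither meets nor touches the [r]-balls of the chosen points. The [8 * r] rounds in
    hand pay for the move, for the [2 * r] rounds to be kept, and for [r] rounds that recognise the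
    smaller balls by tracing walks vertex by vertex.

    What the game needs of the class [K n], besides acyclicity, is closure under subgraphs and
    disjoint sums ([Kgraph_sum]).

    Decidability involves no proof calculus: a Gödel number bounds the quantifier rank, so the size
    of a sufficient finite graph is computed from it directly. *)

Definition env_app (M : Type) m k (u : 'I_m -> M) (v : 'I_k -> M) :
    'I_(m + k) -> M :=
  fun i => match split i with inl j => u j | inr j => v j end.

Lemma env_appl (M : Type) m k (u : 'I_m -> M) (v : 'I_k -> M) i :
  env_app u v (lshift k i) = u i.
Proof. by rewrite /env_app (unsplitK (inl i)). Qed.

Lemma env_appr (M : Type) m k (u : 'I_m -> M) (v : 'I_k -> M) i :
  env_app u v (rshift m i) = v i.
Proof. by rewrite /env_app (unsplitK (inr i)). Qed.

Lemma env_cons0 (M : Type) k (a : M) (v : 'I_k -> M) : env_cons a v ord0 = a.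
Proof. by rewrite /env_cons unlift_none. Qed.

Lemma env_consS (M : Type) k (a : M) (v : 'I_k -> M) i :
  env_cons a v (lift ord0 i) = v i.
Proof. by rewrite /env_cons liftK. Qed.

Lemma env_cons_app (M : Type) m k (a : M) (u : 'I_m -> M) (v : 'I_k -> M) :
  env_cons a (env_app u v) = env_app (env_cons a u) v.
Proof.
apply/funext => i.
case: (unliftP ord0 i) => [j ->|->]; last first.
  have -> : (ord0 : 'I_(m.+1 + k)) = lshift k ord0 by apply/val_inj.
  rewrite env_appl env_cons0.
  have -> : lshift k ord0 = (ord0 : 'I_(m + k).+1) by apply/val_inj.
  by rewrite env_cons0.
rewrite env_consS -{1 2}(splitK j); case: (split j) => {}j /=.
  have -> : lift ord0 (lshift k j) = lshift k (lift ord0 j) :> 'I_(m.+1 + k)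
    by apply/val_inj.
  by rewrite !env_appl env_consS.
have -> : lift ord0 (rshift m j) = rshift m.+1 j :> 'I_(m.+1 + k)
  by apply/val_inj.
by rewrite !env_appr.
Qed.

Lemma sat_exs (M : structure) m k (p : formula (m + k)) (v : 'I_k -> M) :
  sat (exs p) v <-> exists u : 'I_m -> M, sat p (env_app u v).
Proof.
elim: m p => [|m IH] p /=.
  have e (u : 'I_0 -> M) : env_app u v = v.
    apply/funext => i; have {1}-> : i = rshift 0 i by apply/val_inj.
    by rewrite env_appr.
  split=> [h|[u]]; last by rewrite e.
  by exists (no_var M); rewrite e.
rewrite IH /=; split=> [[u [a]]|[u h]].
  by rewrite env_cons_app => h; exists (env_cons a u).
exists (u \o lift ord0), (u ord0); rewrite env_cons_app.
rewrite (_ : env_cons _ _ = u) //; apply/funext => i.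
by case: (unliftP ord0 i) => [j|] ->; rewrite ?env_consS ?env_cons0.
Qed.

Lemma sat_and (M : structure) m k (P : pred 'I_m) (F : 'I_m -> formula k)
    (v : 'I_k -> M) :
  sat (\AND_(i < m | P i) F i) v <-> forall i, P i -> sat (F i) v.
Proof.
suff h (r : seq 'I_m) : sat (\big[@FAnd k/FTop]_(i <- r | P i) F i) v <->
    forall i, i \in r -> P i -> sat (F i) v.
  rewrite h; split=> H i; first by apply: H; rewrite mem_index_enum.
  by move=> _; apply: H.
elim: r => [|x r IH]; first by rewrite big_nil /=; split=> // _ i.
rewrite big_cons; case: ifP => Px /=.
  rewrite IH; split=> [[h1 h2] i|h].
    by rewrite inE => /orP[/eqP->//|]; apply: h2.
  by split=> [|i ir]; apply: h => //; rewrite inE ?eqxx ?ir ?orbT.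
rewrite IH; split=> h i; last by move=> ir; apply: h; rewrite inE ir orbT.
by rewrite inE => /orP[/eqP->|]; [rewrite Px | apply: h].
Qed.

Lemma sat_distinct (M : structure) m k (y : 'I_m -> 'I_k) (v : 'I_k -> M) :
  sat (distinct y) v <-> injective (v \o y).
Proof.
rewrite sat_and; split=> [h i j /= e|h i _]; last first.
  rewrite sat_and => j ij /= /h e; by rewrite e ltnn in ij.
have hn (i' j' : 'I_m) : i' < j' -> v (y i') <> v (y j').
  by move=> lij; have /sat_and := h i' isT; apply.
by apply/val_inj; case: (ltngtP i j) => // /hn; rewrite e.
Qed.

Lemma sat_walk (M : structure) m k (y : 'I_m -> 'I_k) (v : 'I_k -> M) :
  sat (walk y) v <->
  forall i j : 'I_m, j = i.+1 :> nat -> rel_of (v (y i)) (v (y j)).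
Proof.
rewrite sat_and; split=> [h i j /eqP|h i _].
  by have /sat_and := h i isT; apply.
by apply/sat_and => j /eqP; apply: h.
Qed.

(** * Forests *)

Definition acyclic (G : graph) :=
  forall p : seq G, uniq p -> 2 < size p -> ~~ cycle (@adj G) p.

(** The path [p] may return to [x]: as in [theta], its vertices are only distinct among
    themselves. *)
Definition theta_prop (n : nat) (G : graph) :=
  forall (x : G) (z p : seq G), uniq z -> size z = n.+2 ->
    all (adj x) z -> size p = (2 * n)%N -> uniq p -> ~~ path (@adj G) x p.

Definition Kgraph n (G : graph) := acyclic G /\ theta_prop n G.

Lemma uniq_codom_inj m (T : eqType) (f : 'I_m -> T) :
  uniq (codom f) <-> injective f.
Proof. by split=> [/injectiveP|/injectiveP]. Qed.

Lemma nth_codom_ord m (T : Type) (x0 : T) (f : 'I_m -> T) (i : 'I_m) :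
  nth x0 (codom f) i = f i.
Proof. by rewrite (nth_map i) ?size_enum_ord // nth_ord_enum. Qed.

Lemma seq_codom (T : Type) (s : seq T) m : size s = m ->
  exists f : 'I_m -> T, codom f = s.
Proof.
move=> <-; exists (tnth (in_tuple s)).
exact: (map_tnth_enum (in_tuple s)).
Qed.


Lemma cycle_nthP (T : eqType) (e : rel T) x0 (p : seq T) :
  reflect (forall i, i < size p -> e (nth x0 p i) (nth x0 p (i.+1 %% size p)))
          (cycle e p).
Proof.
case: p => [|x p] /=; first by apply: ReflectT.
apply: (iffP (pathP x0)) => h i ip.
  have := h i; rewrite size_rcons => /(_ ip).
  rewrite -rcons_cons nth_rcons /= ip nth_rcons.
  move: ip; rewrite ltnS leq_eqVlt => /orP[/eqP->|ip].
    by rewrite ltnn eqxx modnn.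
  by rewrite ip modn_small ?ltnS.
move: ip; rewrite size_rcons => ip; have := h i ip.
rewrite -rcons_cons nth_rcons /= ip nth_rcons.
move: ip; rewrite ltnS leq_eqVlt => /orP[/eqP->|ip].
  by rewrite ltnn eqxx modnn.
by rewrite ip modn_small ?ltnS.
Qed.

Lemma models_no_cycle (G : graph) k : 2 < k ->
  models G (no_cycle k) <->
  forall p : seq G, uniq p -> size p = k -> ~~ cycle (@adj G) p.
Proof.
move=> k3; rewrite /models /no_cycle /=.
split=> [h p up sp|h /sat_exs [u /= [/sat_distinct du /sat_and cu]]].
  apply/negP => cp; apply: h; apply/sat_exs.
  have [f fp] := seq_codom sp; exists f => /=; split.
    apply/sat_distinct => i j /=; rewrite !env_appl; move: i j.
    by apply/uniq_codom_inj; rewrite fp.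
  apply/sat_and => i _ /=; rewrite !env_appl.
  have /(cycle_nthP _ (f i)) /(_ i) := cp.
  rewrite -fp size_codom card_ord ltn_ord => /(_ isT).
  by rewrite nth_codom_ord (nth_codom_ord _ _ (ordS i)).
have uu : uniq (codom u).
  by apply/uniq_codom_inj => i j e; apply: du; rewrite /= !env_appl.
apply/negP: (h _ uu (etrans (size_codom u) (card_ord k))); rewrite negbK.
case: k k3 u h du cu uu => // k k3 u h du cu uu.
apply/(cycle_nthP _ (u ord0)) => i; rewrite size_codom card_ord => ik.
have := cu (Ordinal ik) isT; rewrite /= !env_appl.
by rewrite -(nth_codom_ord (u ord0) u (ordS _)) -(nth_codom_ord (u ord0) u).
Qed.

Lemma models_theta (G : graph) n :
  models G (theta n) <-> theta_prop n G.
Proof.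
rewrite /models /theta /theta_prop /=; split=> h x.
  move=> z p uz sz az sp up; apply/negP => pp; apply: (h x); last first.
    apply/sat_exs; have [f fp] := seq_codom sp; exists f => /=; split.
      apply/sat_and => i /eqP i0 /=; rewrite env_appl env_appr.
      rewrite env_cons0 -(nth_codom_ord x f) i0 fp.
      have: 0 < size p by rewrite sp; apply: leq_ltn_trans (ltn_ord i).
      by case: (p) pp => //= a l /andP[].
    split.
      apply/sat_distinct => i j /=; rewrite !env_appl; move: i j.
      by apply/uniq_codom_inj; rewrite fp.
    apply/sat_walk => i j ij /=; rewrite !env_appl -!(nth_codom_ord x f) fp.
    have /(pathP x) /(_ j) := pp; rewrite ij /= sp; apply.
    by rewrite -ij ltn_ord.
  apply/sat_exs; have [f fp] := seq_codom sz; exists f => /=; split.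
    apply/sat_distinct => i j /=; rewrite !env_appl; move: i j.
    by apply/uniq_codom_inj; rewrite fp.
  apply/sat_and => i _ /=; rewrite env_appl env_appr env_cons0.
  by apply: (allP az); rewrite -fp codom_f.
move=> /sat_exs[u /= [/sat_distinct du /sat_and au]].
move=> /sat_exs[w /= [/sat_and aw [/sat_distinct dw /sat_walk ww]]].
have uu : uniq (codom u).
  by apply/uniq_codom_inj => i j e; apply: du; rewrite /= !env_appl.
have uw : uniq (codom w).
  by apply/uniq_codom_inj => i j e; apply: dw; rewrite /= !env_appl.
have xu : all (adj x) (codom u).
  apply/allP => _ /codomP[i ->]; have := au i isT.
  by rewrite /= env_appl env_appr env_cons0.
have cu := etrans (size_codom u) (card_ord _).
have cw := etrans (size_codom w) (card_ord _).
apply/negP: (h x _ _ uu cu xu cw uw); rewrite negbK.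
apply/(pathP x) => i; rewrite size_codom card_ord => im.
have -> : nth x (codom w) i = w (Ordinal im)
  by rewrite -(nth_codom_ord x w).
case: i im => [|i] im /=.
  by have := aw (Ordinal im) (eqxx _); rewrite /= env_appl env_appr env_cons0.
have -> : nth x (codom w) i = w (Ordinal (ltnW im))
  by rewrite -(nth_codom_ord x w).
have := ww (Ordinal (ltnW im)) (Ordinal im) erefl.
by rewrite /= !env_appl.
Qed.

(** * Cycles, leaves and the sign of δ *)

Definition degin (G : graph) (B : {fset G}) (x : G) : nat :=
  \sum_(y <- B) adj x y.

(** The link between cycles and δ: in any graph this is equivalent to having no cycle, and also to δ
    being positive on nonempty finite sets. *)
Definition thin (G : graph) := forall B : {fset G}, B != fset0 ->
  exists2 x, x \in B & degin B x <= 1.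

Lemma degin_ge2 (G : graph) (B : {fset G}) x :
  1 < degin B x -> forall y, exists2 z, z \in B & adj x z && (z != y).
Proof.
move=> d y; apply: contrapT => h; move: d; apply/negP; rewrite -leqNgt.
have adj0 z : z \in B -> z != y -> adj x z = false.
  move=> zB zy; apply/negP => az; apply: h; exists z => //.
  by rewrite az.
rewrite /degin; case: (boolP (y \in B)) => yB; last first.
  rewrite big_seq big1 // => z zB; rewrite adj0 //.
  by apply: contraNneq yB => <-.
rewrite (big_fsetD1 y) //= big_seq big1 ?addn0 ?leq_b1 // => z.
by rewrite !inE => /andP[zy zB]; rewrite adj0.
Qed.

Lemma degin_two (G : graph) (B : {fset G}) x y z :
  y \in B -> z \in B -> y != z -> adj x y -> adj x z -> 1 < degin B x.
Proof.
move=> yB zB yz xy xz; rewrite /degin (big_fsetD1 y) //= xy.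
rewrite (big_fsetD1 z) ?xz //=; last by rewrite !inE eq_sym yz.
Qed.

(** If every vertex of [B] had two neighbours in [B], a simple path in [B] could be prolonged at its
    head forever: a neighbour of the head other than the second vertex is new, or closes a cycle.
    But [B] is finite. *)
Lemma acyclic_thin (G : graph) : acyclic G -> thin G.
Proof.
move=> ac B B0; apply: contrapT => h.
have {h} d2 x : x \in B -> 1 < degin B x.
  by move=> xB; rewrite ltnNge; apply/negP => d; apply: h; exists x.
have [x0 x0B] := fset0Pn _ B0.
have long m : exists x y p, [/\ path (@adj G) x (y :: p), uniq [:: x, y & p],
    {subset [:: x, y & p] <= B} & m <= size p].
  elim: m => [|m [x [y [p [xp up sp mp]]]]].
    have [y yB /andP[xy _]] := degin_ge2 (d2 _ x0B) x0.
    exists x0, y, [::]; split=> //=.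
    - by rewrite xy.
    - rewrite inE andbT; apply: contraTneq xy => ->; by rewrite adj_irr.
    by move=> u; rewrite !inE => /orP[]/eqP->.
  have xB : x \in B by apply: sp; rewrite inE eqxx.
  have [z zB /andP[xz zy]] := degin_ge2 (d2 _ xB) y.
  have zx : z != x by apply: contraTneq xz => ->; rewrite adj_irr.
  case: (boolP (z \in p)) => zp; last first.
    exists z, x, (y :: p); split=> //=.
    - by move: xp => /= ->; rewrite andbT adj_sym.
    - by move: up => /= ->; rewrite !inE !negb_or zx zy zp.
    by move=> u; rewrite inE => /orP[/eqP->|/sp].
  (* The segment from [x] to [z] closes up; as [z] comes after [y], the cycle has at least three
     vertices. *)
  case/splitPr: zp xp up sp mp => p1 p2 xp up _ _.
  have ncyc : ~~ cycle (@adj G) (x :: y :: rcons p1 z).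
    apply: ac; last by rewrite /= size_rcons.
    by move: up; rewrite -cat_rcons -!cat_cons cat_uniq => /andP[].
  case/negP: ncyc; rewrite /= !rcons_path last_rcons (adj_sym z) xz andbT.
  by move: xp; rewrite /= cat_path /= => /and4P[-> -> ->].
have [x [y [p [_ up sp]]]] := long #|` B|.
have := uniq_leq_size up sp; rewrite /= => h1 h2; move: h1 h2; rewrite cardfE.
by rewrite -cardfE; lia.
Qed.

(** Inside the vertex set of a cycle every vertex has degree at least 2, by its predecessor and its
    successor; a rotation brings the vertex to the front. *)
Lemma thin_acyclic (G : graph) : thin G -> acyclic G.
Proof.
move=> th p up sp; apply/negP => cp.
have /th[x] : [fset x in p] != fset0.
  by apply/fset0Pn; case: (p) sp => // x l _; exists x; rewrite !inE eqxx.
rewrite !inE /= => /rot_to[i q rq]; apply/negP; rewrite -ltnNge.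
move: sp cp up; rewrite -(size_rot i) -(rot_cycle i) -(rot_uniq i p) rq.
have memp u : u \in p = (u \in x :: q) by rewrite -rq mem_rot.
case/lastP: q {rq} memp => [//|q z]; case: q => [//|y q] memp _.
rewrite /= rcons_path last_rcons => /and3P[xy _ zx] /andP[_ /andP[yz _]].
apply: (@degin_two _ _ _ y z); rewrite ?inE /= ?memp //.
- by rewrite !inE eqxx orbT.
- by rewrite !inE mem_rcons inE eqxx !orbT.
- by apply: contraNneq yz => ->; rewrite mem_rcons inE eqxx.
by rewrite adj_sym.
Qed.

(** Twice the number of edges inside [B], but summed over the ambient graph, so that deleting a
    vertex does not change the type of vertices. *)
Definition npairs (G : graph) (B : {fset G}) : nat := \sum_(x <- B) degin B x.

Lemma card_edges (A : Defs.fgraph) :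
  #|[set p : A * A | fadj p.1 p.2]| = 2 * #|edges A|.
Proof.
set D := [set p : A * A | _].
have -> : edges A = [set [set p.1; p.2] | p in D].
  by apply/setP => e; apply/imsetP/imsetP => -[p ph ->]; exists p => //;
    rewrite ?inE in ph *.
rewrite -sum1_card (partition_big_imset (fun p : A * A => [set p.1; p.2])) /=.
rewrite (eq_bigr (fun=> 2)) ?sum_nat_const 1?mulnC // => e.
case/imsetP => -[a b]; rewrite inE /= => ab ->{e}.
have nab : a != b by apply: contraTneq ab => ->; rewrite fadj_irr.
rewrite sum1dep_card.
rewrite (_ : finset _ = [set (a, b); (b, a)]); last first.
  apply/setP => -[u v]; rewrite !inE /=; apply/andP/idP; last first.
    case/orP => /eqP[-> ->]; first by rewrite ab.
    by rewrite fadj_sym ab setUC.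
  case=> uv /eqP e.
  have := set21 u v; rewrite e !inE => /orP[]/eqP eu; subst u.
    have := set22 a v; rewrite e !inE => /orP[]/eqP ev; subst v.
      by rewrite fadj_irr in uv.
    by rewrite eqxx.
  have := set22 b v; rewrite e !inE => /orP[]/eqP ev; subst v.
    by rewrite eqxx orbT.
  by rewrite fadj_irr in uv.
by rewrite cards2 xpair_eqE (negbTE nab).
Qed.

Lemma npairsE (G : graph) (B : {fset G}) :
  npairs B = 2 * #|edges (induced B)|.
Proof.
rewrite -card_edges -sum1dep_card big_mkcond /=.
rewrite -(pair_bigA _ (fun x y : induced B => if fadj x y then 1 else 0)) /=.
rewrite /npairs big_seq_fsetE; apply: eq_bigr => x _.
by rewrite /degin big_seq_fsetE; apply: eq_bigr => y _; rewrite /induced_adj; case: adj.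
Qed.

Lemma delta_npairs (G : graph) (B : {fset G}) :
  (delta (induced B) * 2 = (2 * #|` B|)%:Z - (npairs B)%:Z)%R.
Proof. by rewrite npairsE /delta -cardfE; lia. Qed.

Lemma npairs_rem (G : graph) (B : {fset G}) x : x \in B ->
  npairs B = npairs (B `\ x) + 2 * degin B x.
Proof.
move=> xB; rewrite /npairs (big_fsetD1 x) //=.
have degD y : y \in B `\ x -> degin B y = adj x y + degin (B `\ x) y.
  by move=> yB; rewrite /degin (big_fsetD1 x) //= adj_sym.
rewrite [in X in _ + X = _]big_seq (eq_bigr _ degD) -big_seq big_split /=.
rewrite addnA addnC mul2n -addnn; congr (_ + (_ + _)).
by rewrite [RHS](big_fsetD1 x) //= adj_irr.
Qed.

(** Deleting a vertex of degree at most 1 lowers the left side by at most 2 and the right side by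
    exactly 2; a single vertex has no pairs. *)
Lemma thin_delta (G : graph) : thin G ->
  forall B : {fset G}, B != fset0 -> npairs B < 2 * #|` B|.
Proof.
move=> th B; move: {2}#|` B| (erefl #|` B|) => m.
elim: m B => [|m IH] B cB B0; first by rewrite (cardfs0_eq cB) eqxx in B0.
have [x xB dx] := th _ B0; rewrite (npairs_rem xB).
have cD := cardfsD1 x B; rewrite xB cB in cD.
have [e|D0] := eqVneq (B `\ x) fset0; last by have := IH (B `\ x); lia.
have -> : npairs (B `\ x) = 0 by rewrite e /npairs big_seq_fset0.
have -> : degin B x = 0; last by rewrite cB.
by rewrite /degin (big_fsetD1 x) //= adj_irr e big_seq_fset0.
Qed.

(** The average degree in [B] is below 2, so some vertex has degree at most 1. *)
Lemma delta_thin (G : graph) :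
  (forall B : {fset G}, B != fset0 -> npairs B < 2 * #|` B|) -> thin G.
Proof.
move=> h B /h lt; apply: contrapT => hB; move: lt; apply/negP; rewrite -leqNgt.
rewrite /npairs big_seq_fsetE /= cardfE mulnC -sum_nat_const.
apply: leq_sum => x _; rewrite ltnNge; apply/negP => dx.
by apply: hB; exists (val x) => //; apply: valP.
Qed.

Lemma K_omega_acyclic (A : Defs.fgraph) : K_omega A <-> acyclic A.
Proof.
split=> [h|/acyclic_thin /thin_delta h B /h].
  apply: thin_acyclic; apply: delta_thin => B /h.
  by have := @delta_npairs A B; lia.
by have := @delta_npairs A B; lia.
Qed.

Lemma K_Kgraph n (A : Defs.fgraph) : K n A <-> Kgraph n A.
Proof. by rewrite /K K_omega_acyclic models_theta. Qed.

Definition noout (G : graph) (A : G -> Prop) :=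
  forall x y, A x -> adj x y -> A y.

(** Adding to [A] an outside neighbour brings one vertex and at least one edge, so δ would not
    increase. *)
Lemma closed_in_noout (G : graph) (A : {fset G}) :
  closed_in A -> noout (fun x => x \in A).
Proof.
move=> cl x y xA xy; apply: contrapT => /negP yA.
have [_ /(_ (y |` A))] := cl _ (fsubsetUr [fset y] A).
have pA : A `<` y |` A by rewrite fproperEcard fsubsetUr cardfsU1 yA /=; lia.
move=> /(_ pA (fsubset_refl _)).
have := delta_npairs A; have := delta_npairs (y |` A).
rewrite (@npairs_rem _ (y |` A) y) ?in_fset1U ?eqxx // fsetU1K //.
rewrite cardfsU1 yA.
have : 0 < degin (y |` A) y; last by lia.
by rewrite /degin (big_fsetD1 x) ?in_fset1U ?xA ?orbT //= adj_sym xy.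
Qed.

(** If no edge leaves [A], then δ of [C] is the sum of δ of [A] and δ of the rest, which is positive
    in a forest. *)
Lemma noout_closed_in (G : graph) (A : {fset G}) : acyclic G ->
  noout (fun x => x \in A) -> closed_in A.
Proof.
move=> /acyclic_thin /thin_delta th no B AB; split=> // C AC CB.
have AC' := fproper_sub AC.
have pC : perm_eq C (A ++ (C `\` A)).
  apply: uniq_perm; rewrite ?fset_uniq //.
    rewrite cat_uniq !fset_uniq andbT /=; apply/hasPn => x.
    by rewrite inE => /andP[].
  move=> x; rewrite mem_cat inE; case: (boolP (x \in A)) => //= xA.
  exact: (fsubsetP AC').
have npC : npairs C = npairs A + npairs (C `\` A).
  rewrite /npairs (perm_big _ pC) big_cat; congr (_ + _).
    rewrite big_seq [RHS]big_seq; apply: eq_bigr => x xA.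
    rewrite /degin (perm_big _ pC) big_cat /= [X in _ + X]big_seq.
    rewrite [X in _ + X]big1 ?addn0 // => y; rewrite inE => /andP[yA _].
    by apply/eqP; rewrite eqb0; apply: contra yA; apply: no.
  rewrite big_seq [RHS]big_seq; apply: eq_bigr => x; rewrite inE => /andP[xA _].
  rewrite /degin (perm_big _ pC) big_cat /= [X in X + _]big_seq big1 // => y yA.
  by apply/eqP; rewrite eqb0 adj_sym; apply: contra xA; apply: no.
have D0 : C `\` A != fset0.
  rewrite -cardfs_gt0 cardfsDS // subn_gt0.
  exact: fproper_ltn_card.
have := th _ D0; rewrite cardfsDS //.
have := fproper_ltn_card AC.
by have := delta_npairs A; have := delta_npairs C; lia.
Qed.

Lemma path_const (G : graph) (I : Type) (c : G -> I) x p :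
  (forall x y : G, adj x y -> c x = c y) -> path (@adj G) x p ->
  forall y, y \in x :: p -> c y = c x.
Proof.
move=> hc; elim: p x => [|z p IH] x /=; first by move=> _ y; rewrite inE => /eqP->.
case/andP => xz /IH h y; rewrite inE => /orP[/eqP-> //|/h ->].
exact/esym/hc.
Qed.

Lemma path_map_in (T : eqType) (G : graph) (e : rel T) (f : T -> G) x p :
  {in x :: p &, forall u v, e u v -> adj (f u) (f v)} ->
  path e x p -> path (@adj G) (f x) (map f p).
Proof.
elim: p x => //= y p IH x h /andP[xy yp].
rewrite h ?inE ?eqxx ?orbT //=; apply: IH => // u v up vp.
by apply: h; rewrite inE ?up ?vp orbT.
Qed.

(** A cycle, or a violation of [theta_prop], is connected and so lies in one class of [c], whence
    [f] carries it into a single [H i]. Both subgraphs (one class) and disjoint unions are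
    instances. *)
Lemma Kgraph_sum n (G : graph) (I : Type) (c : G -> I) (H : I -> graph)
    (f : forall i, G -> H i) :
  (forall x y : G, adj x y -> c x = c y) ->
  (forall x y : G, c x = c y -> f (c x) x = f (c x) y -> x = y) ->
  (forall x y : G, adj x y -> adj (f (c x) x) (f (c x) y)) ->
  (forall i, Kgraph n (H i)) -> Kgraph n G.
Proof.
move=> hc hinj hadj hK; split=> [p up sp|x z p uz sz az sp up].
  case: p up sp => // x p up sp; apply/negP => /= cp.
  have cst := path_const hc cp.
  have cstp y : y \in x :: p -> c y = c x.
    by move=> yp; apply: cst; rewrite -rcons_cons mem_rcons inE yp orbT.
  have /negP[] : ~~ cycle (@adj (H (c x))) (map (f (c x)) (x :: p)).
    apply: (hK (c x)).1; last by rewrite size_map.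
    rewrite map_inj_in_uniq // => u v /cstp cu /cstp cv.
    by move=> e; apply: hinj; rewrite cu ?cv.
  rewrite /= -map_rcons; apply: path_map_in cp => u v /cst cu _.
  by rewrite -cu; apply: hadj.
apply/negP => pp; have cst := path_const hc pp.
have cstz y : y \in z -> c y = c x by move=> yz; apply/esym/hc/(allP az).
have inj_f (s : seq G) : (forall y, y \in s -> c y = c x) ->
    uniq s -> uniq (map (f (c x)) s).
  move=> cs us; rewrite map_inj_in_uniq // => u v /cs cu /cs cv.
  by move=> e; apply: hinj; rewrite cu ?cv.
have /negP[] : ~~ path (@adj (H (c x))) (f (c x) x) (map (f (c x)) p).
  apply: ((hK (c x)).2 _ (map (f (c x)) z)); rewrite ?size_map //.
  - exact: inj_f.
  - by apply/allP => _ /mapP[y yz ->]; apply/hadj/(allP az).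
  - by apply: inj_f => // y yp; apply: cst; rewrite inE yp orbT.
by apply: path_map_in pp => u v /cst cu _; rewrite -cu; apply: hadj.
Qed.

Lemma Kgraph_embed n (G H : graph) (f : G -> H) :
  injective f -> (forall x y : G, adj x y -> adj (f x) (f y)) ->
  Kgraph n H -> Kgraph n G.
Proof.
move=> inj hf KH.
apply: (@Kgraph_sum n G unit (fun=> tt) (fun=> H) (fun=> f)) => //.
by move=> x y _; apply: inj.
Qed.

Lemma Kgraph_induced n (G : graph) (A : {fset G}) :
  Kgraph n G -> Kgraph n (induced A).
Proof. by apply: (@Kgraph_embed n (induced A) G val) => //; apply: val_inj. Qed.

Section Copies.
Variables (A : Defs.fgraph) (m : nat).
Definition copies_adj : rel (A * 'I_m) :=
  fun x y => (x.2 == y.2) && fadj x.1 y.1.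
Fact copies_sym : symmetric copies_adj.
Proof. by move=> x y; rewrite /copies_adj eq_sym fadj_sym. Qed.
Fact copies_irr : irreflexive copies_adj.
Proof. by move=> x; rewrite /copies_adj fadj_irr andbF. Qed.
Definition copies := FGraph copies_sym copies_irr.
End Copies.

Lemma Kgraph_copies n (A : Defs.fgraph) m : Kgraph n A -> Kgraph n (copies A m).
Proof.
move=> KA; apply: (@Kgraph_sum n (copies A m) _ snd (fun=> A) (fun=> fst)) => //.
- by move=> x y /andP[/eqP].
- by move=> [x i] [y j] /= -> ->.
by move=> x y /andP[].
Qed.

Definition component_embedding (A G : graph) (f : A -> G) :=
  [/\ injective f, forall x y, adj (f x) (f y) = adj x y
    & forall x y, adj (f x) y -> exists z, y = f z].

Definition rich n (G : graph) (s : nat) := forall A : Defs.fgraph,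
  K n A -> #|A| <= s -> exists f : A -> G, component_embedding f.

Lemma closed_embeddingP (A : Defs.fgraph) (G : graph) (f : A -> G) :
  acyclic G -> closed_embedding f <-> component_embedding f.
Proof.
move=> ac; split=> -[inj hf h]; split=> //.
  move=> x y xy; have := closed_in_noout h _ xy.
  by case/(_ (in_imfset _ _ _))/imfsetP => // z _ ->; exists z.
apply: noout_closed_in => // _ y /imfsetP[x _ ->] /h [z ->].
exact: in_imfset.
Qed.

(** * Ehrenfeucht-Fraisse games *)

Definition piso (M N : graph) (Z : M -> N -> Prop) :=
  forall a b a' b', Z a b -> Z a' b' ->
    (a = a' <-> b = b') /\ adj a a' = adj b b'.

Definition ext (M N : graph) (Z : M -> N -> Prop) a b : M -> N -> Prop :=
  fun x y => Z x y \/ (x = a /\ y = b).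

Definition pt (M N : graph) (a : M) (b : N) : M -> N -> Prop :=
  fun x y => x = a /\ y = b.

(* Moves are confined to [P] and [Q].  Positions are relations rather than
   tuples, so that the order in which the pairs were chosen is forgotten. *)
Fixpoint ef (M N : graph) k (P : M -> Prop) (Q : N -> Prop)
    (Z : M -> N -> Prop) : Prop :=
  piso Z /\
  if k is k'.+1 then
    (forall a, P a -> exists b, Q b /\ ef k' P Q (ext Z a b)) /\
    (forall b, Q b -> exists a, P a /\ ef k' P Q (ext Z a b))
  else True.

Section Ef.
Variables M N : graph.
Implicit Types (P : M -> Prop) (Q : N -> Prop) (Z : M -> N -> Prop).

Lemma ef_piso k P Q Z : ef k P Q Z -> piso Z.
Proof. by case: k => [|k] []. Qed.

Lemma efS k P Q Z : ef k.+1 P Q Z ->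
  (forall a, P a -> exists b, Q b /\ ef k P Q (ext Z a b)) /\
  (forall b, Q b -> exists a, P a /\ ef k P Q (ext Z a b)).
Proof. by case. Qed.

Lemma ef_anti k P Q Z Z' : (forall x y, Z x y -> Z' x y) ->
  ef k P Q Z' -> ef k P Q Z.
Proof.
elim: k Z Z' => [|k IH] Z Z' sub /= [p h]; split=> //.
- by move=> a b a' b' /sub z /sub; apply: p.
- by move=> a b a' b' /sub z /sub; apply: p.
case: h => f b; split=> x /[dup] hx; [case/f|case/b] => y [hy e]; exists y.
  by split=> //; apply: IH e => u v [/sub|]; [left|right].
by split=> //; apply: IH e => u v [/sub|]; [left|right].
Qed.

Lemma ef_le k k' P Q Z : k <= k' -> ef k' P Q Z -> ef k P Q Z.
Proof.
elim: k k' Z => [|k IH] [|k'] Z //= le [p h]; split=> //.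
case: h => f b; split=> x /[dup] hx; [case/f|case/b] => y [hy e]; exists y;
  by split=> //; apply: IH e.
Qed.

Lemma ef_eq k P P' Q Q' Z : (forall x, P x <-> P' x) ->
  (forall y, Q y <-> Q' y) -> ef k P Q Z -> ef k P' Q' Z.
Proof.
move=> hP hQ; have -> : P = P' by apply/funext => x; apply/propext.
by have -> : Q = Q' by apply/funext => x; apply/propext.
Qed.

(* Membership in [P'] and [Q'] is detected by [m] further rounds. *)
Lemma ef_restrict k m P P' Q Q' Z :
  (forall x, P' x -> P x) -> (forall y, Q' y -> Q y) ->
  (forall Z' x y, (forall u v, Z u v -> Z' u v) -> ef m P Q Z' -> Z' x y ->
     (P' x <-> Q' y)) ->
  ef (k + m) P Q Z -> ef k P' Q' Z.
Proof.
move=> sP sQ.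
elim: k Z => [|k IH] Z inv; first by move/ef_piso; split.
rewrite addSn => -[p [f b]]; split=> //; split=> x hx.
  have [y [hy e]] := f x (sP _ hx); exists y.
  split; last first.
    apply: IH e => Z' x' y' sub; apply: inv => u v z; apply: sub; by left.
  (* After this answer [k + m] rounds are left, of which [m] suffice to place [y] in [Q']. *)
  apply/(inv (ext Z x y) x y); [by left| |by right|by []].
  by apply: ef_le e; rewrite leq_addl.
have [y [hy e]] := b x (sQ _ hx); exists y.
split; last first.
  apply: IH e => Z' x' y' sub; apply: inv => u v z; apply: sub; by left.
apply/(inv (ext Z y x) y x); [by left| |by right|by []].
by apply: ef_le e; rewrite leq_addl.
Qed.

(** Replying along [Z] never enlarges the position, so this strategy lasts for any number of
    rounds. *)
Lemma ef_iso k P Q Z : piso Z -> (forall x, P x -> exists y, Q y /\ Z x y) ->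
  (forall y, Q y -> exists x, P x /\ Z x y) -> ef k P Q Z.
Proof.
move=> p f b; elim: k => [|k IH] /=; first by split.
have e x y : Z x y -> ef k P Q (ext Z x y).
  by move=> zxy; apply: ef_anti IH => u v [|[-> ->]].
split=> //; split=> x hx.
  by have [y [hy z]] := f x hx; exists y; split=> //; apply: e.
by have [y [hy z]] := b x hx; exists y; split=> //; apply: e.
Qed.

(** The vertices of [p] are played one by one, at one round each, and the replies form [p']; since
    [u] is already paired with [v], the last reply must be [v]. *)
Lemma ef_trace k P Q Z a b u v p : ef k P Q Z -> Z a b -> Z u v ->
  path (@adj M) a p -> last a p = u -> (forall x, x \in p -> P x) ->
  size p <= k -> exists p', [/\ path (@adj N) b p', last b p' = v,
    size p' = size p & forall y, y \in p' -> Q y].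
Proof.
elim: p k Z a b => [|c p IH] k Z a b e zab zuv /=.
  move=> _ au _ _; exists [::]; split=> //=.
  by have [[<- //] _] := ef_piso e zab zuv.
case/andP => ac cp lc hP sk; case: k sk e => [//|k] sk [pi [f _]].
have [d [Qd e]] := f c (hP c (mem_head _ _)).
have [p' [pp lp sp' Qp]] : exists p', [/\ path (@adj N) d p', last d p' = v,
    size p' = size p & forall y, y \in p' -> Q y].
  apply: (IH _ _ _ _ e _ _ cp lc) => //; [by right|by left|].
  by move=> x xp; apply: hP; rewrite inE xp orbT.
exists (d :: p'); split=> /=; rewrite ?pp ?sp' ?andbT //.
  have zab' : ext Z c d a b by left.
  have zcd : ext Z c d c d by right.
  by have [_ <-] := ef_piso e zab' zcd.
by move=> y; rewrite inE => /orP[/eqP->|/Qp].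
Qed.

End Ef.

Lemma ef_sym (M N : graph) k (P : M -> Prop) (Q : N -> Prop) Z :
  ef k P Q Z -> ef k Q P (fun y x => Z x y).
Proof.
elim: k Z => [|k IH] Z /= [p h]; split=> //.
- by move=> b a b' a' z z'; have [? ->] := p _ _ _ _ z z'; split=> //; tauto.
- by move=> b a b' a' z z'; have [? ->] := p _ _ _ _ z z'; split=> //; tauto.
case: h => f b; split=> x hx; [have := b x hx|have := f x hx] => -[y [hy e]];
  exists y; split=> //; apply: ef_anti (IH _ e) => u v [?|[-> ->]];
  by [left|right].
Qed.

Lemma ef_comp (M N L : graph) k (P : M -> Prop) (Q : N -> Prop)
    (S : L -> Prop) Z W :
  ef k P Q Z -> ef k Q S W ->
  ef k P S (fun x z => exists2 y, Z x y & W y z).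
Proof.
elim: k Z W => [|k IH] Z W /= [p h] [p' h'].
  split=> // a c a' c' [b z w] [b' z' w'].
  by have [-> ->] := p _ _ _ _ z z'; apply: p'.
split.
  move=> a c a' c' [b z w] [b' z' w'].
  by have [-> ->] := p _ _ _ _ z z'; apply: p'.
have aux a b c : ef k P Q (ext Z a b) -> ef k Q S (ext W b c) ->
    ef k P S (ext (fun x z => exists2 y, Z x y & W y z) a c).
  move=> e1 e2; apply: ef_anti (IH _ _ e1 e2) => u v [[y z w]|[-> ->]].
    by exists y; left.
  by exists b; right.
case: h h' => f b [f' b']; split=> x hx.
  have [y [hy e]] := f x hx; have [z [hz e']] := f' y hy.
  by exists z; split=> //; apply: aux e e'.
have [y [hy e]] := b' x hx; have [z [hz e']] := b y hy.
by exists z; split=> //; apply: aux e' e.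
Qed.

Definition separated (G : graph) (P1 P2 : G -> Prop) :=
  forall x y, P1 x -> P2 y -> x <> y /\ ~~ adj x y.

(** Each move is answered in the game of its own side while the other game waits. Pairs from
    different sides are distinct and nonadjacent in both graphs, so the union stays a partial
    isomorphism. *)
Lemma ef_union (M N : graph) k (P1 P2 : M -> Prop) (Q1 Q2 : N -> Prop) Z1 Z2 :
  separated P1 P2 -> separated Q1 Q2 ->
  (forall x y, Z1 x y -> P1 x /\ Q1 y) -> (forall x y, Z2 x y -> P2 x /\ Q2 y) ->
  ef k P1 Q1 Z1 -> ef k P2 Q2 Z2 ->
  ef k (fun x => P1 x \/ P2 x) (fun y => Q1 y \/ Q2 y)
    (fun x y => Z1 x y \/ Z2 x y).
Proof.
move=> sP sQ.
have pis (Y1 Y2 : M -> N -> Prop) :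
    (forall x y, Y1 x y -> P1 x /\ Q1 y) ->
    (forall x y, Y2 x y -> P2 x /\ Q2 y) ->
    piso Y1 -> piso Y2 -> piso (fun x y => Y1 x y \/ Y2 x y).
  move=> i1 i2 p1 p2 a b a' b' [y|y] [y'|y'].
  - exact: p1.
  - have [? ?] := i1 _ _ y; have [? ?] := i2 _ _ y'.
    have [? /negbTE->] := sP a a' ltac:(done) ltac:(done).
    by have [? /negbTE->] := sQ b b' ltac:(done) ltac:(done).
  - have [? ?] := i2 _ _ y; have [? ?] := i1 _ _ y'.
    rewrite (adj_sym a) (adj_sym b).
    have [? /negbTE->] := sP a' a ltac:(done) ltac:(done).
    have [? /negbTE->] := sQ b' b ltac:(done) ltac:(done).
    by split=> //; split=> /esym.
  exact: p2.
elim: k Z1 Z2 => [|k IH] Z1 Z2 i1 i2 e1 e2 /=.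
  by split=> //; apply: pis => //; [move: e1|move: e2] => /ef_piso.
split; first by apply: pis => //; [move: e1|move: e2] => /ef_piso.
have [p1 [f1 b1]] := e1; have [p2 [f2 b2]] := e2.
have aux1 a b : P1 a -> Q1 b -> ef k P1 Q1 (ext Z1 a b) ->
    ef k (fun x => P1 x \/ P2 x) (fun y => Q1 y \/ Q2 y)
      (ext (fun x y => Z1 x y \/ Z2 x y) a b).
  move=> Pa Qb e; apply: ef_anti (IH (ext Z1 a b) Z2 _ _ e _) => //.
  - move=> u v [[?|?]|?]; [by left; left|by right|by left; right].
  - by move=> x y [/i1|[-> ->]].
  exact: ef_le e2.
have aux2 a b : P2 a -> Q2 b -> ef k P2 Q2 (ext Z2 a b) ->
    ef k (fun x => P1 x \/ P2 x) (fun y => Q1 y \/ Q2 y)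
      (ext (fun x y => Z1 x y \/ Z2 x y) a b).
  move=> Pa Qb e; apply: ef_anti (IH Z1 (ext Z2 a b) _ _ _ e) => //.
  - move=> u v [[?|?]|?]; [by left|by right; left|by right; right].
  - by move=> x y [/i2|[-> ->]].
  exact: ef_le e1.
split=> x [] hx.
- have [y [hy e]] := f1 x hx; exists y.
  by split; [left|apply: aux1].
- have [y [hy e]] := f2 x hx; exists y.
  by split; [right|apply: aux2].
- have [y [hy e]] := b1 x hx; exists y.
  by split; [left|apply: aux1].
have [y [hy e]] := b2 x hx; exists y.
by split; [right|apply: aux2].
Qed.

(** * Games and quantifier rank *)

Fixpoint qr k (p : formula k) : nat :=
  match p with
  | FEq _ _ _ | FRel _ _ _ | FBot _ => 0
  | FImp _ p q | FAnd _ p q | FOr _ p q => maxn (qr p) (qr q)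
  | FAll _ p | FEx _ p => (qr p).+1
  end.

Lemma ef_sat (M N : graph) k (p : formula k) m Z (v : 'I_k -> M) (w : 'I_k -> N) :
  qr p <= m -> (forall i, Z (v i) (w i)) ->
  ef m (fun=> True) (fun=> True) Z -> sat (M := M) p v <-> sat (M := N) p w.
Proof.
elim: p m Z v w => {k} [k i j|k i j|k|k p IHp q IHq|k p IHp q IHq|k p IHp q IHq
  |k p IHp|k p IHp] m Z v w /= qm zvw e.
- by have [] := ef_piso e (zvw i) (zvw j).
- by have [_ ->] := ef_piso e (zvw i) (zvw j).
- by [].
- rewrite geq_max in qm; case/andP: qm => q1 q2.
  by rewrite (IHp _ _ _ _ q1 zvw e) (IHq _ _ _ _ q2 zvw e).
- rewrite geq_max in qm; case/andP: qm => q1 q2.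
  by rewrite (IHp _ _ _ _ q1 zvw e) (IHq _ _ _ _ q2 zvw e).
- rewrite geq_max in qm; case/andP: qm => q1 q2.
  by rewrite (IHp _ _ _ _ q1 zvw e) (IHq _ _ _ _ q2 zvw e).
- case: m qm e => // m qm [_ [f b]].
  have zext a c i : ext Z a c (env_cons a v i) (env_cons c w i).
    by case: (unliftP ord0 i) => [j|] ->; rewrite ?env_consS ?env_cons0;
      [left|right].
  split=> h x.
    have [a [_ e]] := b x I; exact: (IHp _ _ _ _ qm (zext a x) e).1.
  have [a [_ e]] := f x I; exact: (IHp _ _ _ _ qm (zext x a) e).2.
case: m qm e => // m qm [_ [f b]].
have zext a c i : ext Z a c (env_cons a v i) (env_cons c w i).
  by case: (unliftP ord0 i) => [j|] ->; rewrite ?env_consS ?env_cons0;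
    [left|right].
split=> -[x h].
  have [a [_ e]] := f x I; exists a; exact: (IHp _ _ _ _ qm (zext x a) e).1.
have [a [_ e]] := b x I; exists a; exact: (IHp _ _ _ _ qm (zext a x) e).2.
Qed.

Lemma ef_models (M N : graph) k (p : sentence) : qr p <= k ->
  ef k (fun _ : M => True) (fun _ : N => True) (fun _ _ => False) ->
  models M p <-> models N p.
Proof. by move=> qk; apply: ef_sat => // -[]. Qed.

(* [a] together with subtrees [P c] hanging from the neighbours [c] in [C] *)
Definition fan (G : graph) (a : G) (C : G -> Prop) (P : G -> G -> Prop) :=
  [/\ forall c, C c -> P c c /\ adj a c,
      forall c x, C c -> P c x -> x <> a /\ (adj a x -> x = c)
    & forall c c', C c -> C c' -> c <> c' -> separated (P c) (P c')].

Definition fanset (G : graph) (a : G) (C : G -> Prop) (P : G -> G -> Prop) :=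
  fun x => x = a \/ exists2 c, C c & P c x.

Section Fan.
Variables (M N : graph) (a : M) (b : N) (C : M -> Prop) (D : N -> Prop).
Variables (P : M -> M -> Prop) (Q : N -> N -> Prop) (q : nat).
Variable Match : M -> N -> Prop.
Hypothesis fanP : fan a C P.
Hypothesis fanQ : fan b D Q.
Hypothesis matchC : forall c d, Match c d -> C c.
Hypothesis matchD : forall c d, Match c d -> D d.
Hypothesis match_ef : forall c d, Match c d -> ef q (P c) (Q d) (pt c d).

Let matched (t : seq (M * N)) :=
  [/\ uniq (unzip1 t), uniq (unzip2 t)
    & forall c d, (c, d) \in t -> Match c d].

Hypothesis match_forth : forall t, matched t -> size t < q ->
  forall c, C c -> c \notin unzip1 t -> exists2 d, Match c d & d \notin unzip2 t.
Hypothesis match_back : forall t, matched t -> size t < q ->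
  forall d, D d -> d \notin unzip2 t -> exists2 c, Match c d & c \notin unzip1 t.

(** Here [t] lists the pairs of branches entered so far, and [W c d] is the position reached in the
    separate game on the branches [c] and [d]. *)
Let fanpos k t (W : M -> N -> M -> N -> Prop) :=
  matched t /\ forall c d, (c, d) \in t ->
    [/\ ef k (P c) (Q d) (W c d), W c d c d
      & forall x y, W c d x y -> P c x /\ Q d y].

Let zfan (t : seq (M * N)) (W : M -> N -> M -> N -> Prop) x y :=
  (x = a /\ y = b) \/ exists c d, (c, d) \in t /\ W c d x y.

Let unzip_inj (t : seq (M * N)) c d c' d' : matched t ->
  (c, d) \in t -> (c', d') \in t -> c = c' <-> d = d'.
Proof.
case=> u1 u2 _; elim: t u1 u2 => // -[x y] t IH /= /andP[xt u1] /andP[yt u2].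
rewrite !inE => /orP[/eqP[-> ->]|ct] /orP[/eqP[-> ->]|ct'] //; last exact: IH.
  split=> e; [case/negP: xt; rewrite e|case/negP: yt; rewrite e].
    by apply/mapP; exists (c', d').
  by apply/mapP; exists (c', d').
split=> e; [case/negP: xt; rewrite -e|case/negP: yt; rewrite -e].
  by apply/mapP; exists (c, d).
by apply/mapP; exists (c, d).
Qed.

(** The root sees only the top of a branch, and the tops [c] and [d] are paired in [W c d], so [x]
    is the top exactly when [y] is. *)
Let fan_root k t W : fanpos k t W -> forall c d x y, (c, d) \in t ->
  W c d x y -> [/\ x <> a, y <> b & adj a x = adj b y].
Proof.
case=> -[u1 u2 mt] ht c d x y cd w.
have [e wcd sub] := ht _ _ cd; have m := mt _ _ cd.
have [h1 h2 _] := fanP; have [h1' h2' _] := fanQ.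
have Cc := matchC m; have Dd := matchD m.
have [px qy] := sub _ _ w.
have [xa ax] := h2 _ _ Cc px; have [yb by_] := h2' _ _ Dd qy.
split=> //; apply/idP/idP => [/ax xc|/by_ yd].
  by subst x; have [[<- //] _] := ef_piso e wcd w; have [] := h1' _ Dd.
by subst y; have [[_ <- //] _] := ef_piso e wcd w; have [] := h1 _ Cc.
Qed.

Let fan_piso k t W : fanpos k t W -> piso (zfan t W).
Proof.
move=> fp; have root := fan_root fp; case: fp => mt ht.
move=> x y x' y' [[-> ->]|[c [d [cd w]]]] [[-> ->]|[c' [d' [cd' w']]]].
- by rewrite !adj_irr.
- have [xa yb ->] := root _ _ _ _ cd' w'.
  by split=> //; split=> /esym.
- have [xa yb e] := root _ _ _ _ cd w.
  by rewrite adj_sym e adj_sym; split.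
have inj := unzip_inj mt cd cd'.
have [cc'|cc'] := pselect (c = c').
  have dd' := inj.1 cc'; subst c' d'.
  by have [e _ _] := ht _ _ cd; apply: (ef_piso e).
have dd' : d <> d' by move/inj.
have [_ _ /(_ _ _ w)[px qy]] := ht _ _ cd.
have [_ _ /(_ _ _ w')[px' qy']] := ht _ _ cd'.
have [_ _ mm] := mt; have m := mm _ _ cd; have m' := mm _ _ cd'.
have [_ _ sP] := fanP; have [_ _ sQ] := fanQ.
have [? /negbTE->] := sP _ _ (matchC m) (matchC m') cc' _ _ px px'.
by have [? /negbTE->] := sQ _ _ (matchD m) (matchD m') dd' _ _ qy qy'.
Qed.

(** A round opens at most one new pair of branches, so [k + size t] never grows; before each move it
    leaves [size t < q], as the matching hypotheses require. *)
Let fan_ef k t W : k + size t <= q -> fanpos k t W ->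
  ef k (fanset a C P) (fanset b D Q) (zfan t W).
Proof.
elim: k t W => [|k IH] t W kq fp; first by split=> //; apply: fan_piso fp.
split; first exact: fan_piso fp.
have [mt ht] := fp; have [u1 u2 mm] := mt.
have root : ef k (fanset a C P) (fanset b D Q) (ext (zfan t W) a b).
  apply: ef_anti (IH t W _ _) => [u v [//|[-> ->]]||].
  - by left.
  - by apply: leq_trans kq; rewrite leq_add2r.
  split=> // c d cd; have [e ? ?] := ht _ _ cd; split=> //.
  exact: ef_le e.
(* Only the game on the pair of branches just played changes; [old] continues it, [new] starts it
   from the pair of tops. *)
pose upd c d Z c' d' := if (c' == c) && (d' == d) then Z else W c' d'.
have old c d x y : (c, d) \in t -> P c x -> Q d y ->
    ef k (P c) (Q d) (ext (W c d) x y) ->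
    ef k (fanset a C P) (fanset b D Q) (ext (zfan t W) x y).
  move=> cd px qy e; apply: ef_anti (IH t (upd c d (ext (W c d) x y)) _ _).
  - move=> u v [[?|[c' [d' [cd' w]]]]|[-> ->]]; [by left| |].
      right; exists c', d'; split=> //; rewrite /upd.
      by case: andP w => // -[/eqP-> /eqP-> ?]; left.
    by right; exists c, d; split=> //; rewrite /upd !eqxx; right.
  - by apply: leq_trans kq; rewrite leq_add2r.
  split=> // c' d' cd'; have [e' w sub] := ht _ _ cd'; rewrite /upd.
  case: andP => [[/eqP ec /eqP ed]|_]; last by split=> //; apply: ef_le e'.
  subst c' d'; split=> //; first by left.
  by move=> u v [/sub|[-> ->]].
have new c d x y : c \notin unzip1 t -> d \notin unzip2 t -> Match c d ->
    P c x -> Q d y -> ef k (P c) (Q d) (ext (pt c d) x y) ->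
    ef k (fanset a C P) (fanset b D Q) (ext (zfan t W) x y).
  move=> ct dt m px qy e.
  have neq c' d' : (c', d') \in t -> ((c' == c) && (d' == d)) = false.
    move=> cd'; apply: contraNF ct => /andP[/eqP<- _].
    by apply/mapP; exists (c', d').
  apply: ef_anti (IH ((c, d) :: t) (upd c d (ext (pt c d) x y)) _ _).
  - move=> u v [[?|[c' [d' [cd' w]]]]|[-> ->]]; [by left| |].
      right; exists c', d'; split; first by rewrite inE cd' orbT.
      by rewrite /upd neq.
    by right; exists c, d; split; [rewrite inE eqxx|rewrite /upd !eqxx; right].
  - by apply: leq_trans kq; rewrite /= addnS.
  split.
    split; rewrite /= ?ct ?dt // => c' d'; rewrite inE.
    by case/orP => [/eqP[-> ->]//|]; apply: mm.
  have [h1 _ _] := fanP; have [h1' _ _] := fanQ.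
  move=> c' d'; rewrite inE => /orP[/eqP[-> ->]|cd'].
    rewrite /upd !eqxx; split=> //; first by left.
    move=> u v [[-> ->]|[-> ->] //].
    have [? _] := h1 _ (matchC m); by have [? _] := h1' _ (matchD m).
  rewrite /upd neq //; have [e' ? ?] := ht _ _ cd'; split=> //.
  exact: ef_le e'.
have tq : size t < q by apply: leq_trans kq; rewrite addSn ltnS leq_addl.
have kq' : k < q by apply: leq_trans kq; rewrite leq_addr.
split.
- move=> x [->|[c Cc px]]; first by exists b; split=> //; left.
  have [ct|ct] := boolP (c \in unzip1 t).
    have [[c' d] /= cd ec] := mapP ct; subst c'.
    have [[_ [f _]] _ _] := ht _ _ cd; have [y [qy e]] := f x px.
    exists y; split; last exact: old e.
    by right; exists d => //; apply: matchD (mm _ _ cd).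
  have [d m dt] := match_forth mt tq Cc ct.
  have [_ [f _]] := ef_le kq' (match_ef m); have [y [qy e]] := f x px.
  exists y; split; last exact: new e.
  by right; exists d => //; apply: matchD m.
move=> y [->|[d Dd qy]]; first by exists a; split=> //; left.
have [dt|dt] := boolP (d \in unzip2 t).
  have [[c d'] /= cd ed] := mapP dt; subst d'.
  have [[_ [_ f]] _ _] := ht _ _ cd; have [x [px e]] := f y qy.
  exists x; split; last exact: old e.
  by right; exists c => //; apply: matchC (mm _ _ cd).
have [c m ct] := match_back mt tq Dd dt.
have [_ [_ f]] := ef_le kq' (match_ef m); have [x [px e]] := f y qy.
exists x; split; last exact: new e.
by right; exists c => //; apply: matchC m.
Qed.

(** Branches are paired only when a move falls into them. Hence [Match] need not be a bijection: it
    only has to offer a fresh partner while fewer than [q] pairs are in use, which lets finitely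
    many branches stand for infinitely many. *)
Lemma ef_fan : ef q (fanset a C P) (fanset b D Q) (pt a b).
Proof.
apply: ef_anti (@fan_ef q [::] (fun _ _ _ _ => False) _ _) => //.
- by move=> x y [-> ->]; left.
by rewrite addn0.
Qed.
End Fan.

(** * Balls in forests *)

(** The constraint [P] on the walk serves to forbid vertices nearer to the root: with it, the part
    of a tree hanging below a neighbour is again a ball. *)
Definition ball (G : graph) (P : G -> Prop) r (a x : G) :=
  exists p, [/\ path (@adj G) a p, last a p = x, size p <= r
    & forall y, y \in p -> P y].

Section Ball.
Variable G : graph.
Implicit Types (P : G -> Prop) (a x : G).

Lemma ball_refl P r a : ball P r a a.
Proof. by exists [::]. Qed.

Lemma ball_adj P a x : adj a x -> P x -> ball P 1 a x.
Proof.
move=> ax Px; exists [:: x]; split=> //=; first by rewrite ax.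
by move=> y; rewrite inE => /eqP->.
Qed.

Lemma ball_trans P r s a x y : ball P r a x -> ball P s x y -> ball P (r + s) a y.
Proof.
move=> [p [ap lp sp Pp]] [p' [ap' lp' sp' Pp']]; exists (p ++ p'); split.
- by rewrite cat_path ap lp.
- by rewrite last_cat lp.
- by rewrite size_cat leq_add.
by move=> z; rewrite mem_cat => /orP[/Pp|/Pp'].
Qed.

Lemma ball_sym P r a x : P a -> ball P r a x -> ball P r x a.
Proof.
move=> Pa [p [ap lp sp Pp]]; exists (rev (belast a p)); split.
- by rewrite -lp rev_path (eq_path (fun u v => adj_sym v u)).
- by case: (p) lp => [|z s] //= _; rewrite rev_cons last_rcons.
- by rewrite size_rev size_belast.
move=> y; rewrite mem_rev => /mem_belast; rewrite inE => /orP[/eqP->//|/Pp//].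
Qed.

Lemma ball_le P P' r s a x : r <= s -> (forall y, P y -> P' y) ->
  ball P r a x -> ball P' s a x.
Proof.
move=> rs PP' [p [ap lp sp Pp]]; exists p; split=> //.
  exact: leq_trans rs.
by move=> y /Pp /PP'.
Qed.

Lemma ball_in P r a x : P a -> ball P r a x -> P x.
Proof.
move=> Pa [p [_ <- _ Pp]]; have := mem_last a p; rewrite inE.
by case/orP => [/eqP->//|/Pp].
Qed.

(** Shortened to a simple path, the walk never returns to [a], so after its first step it stays in
    the branch of its second vertex. *)
Lemma ballS P r a x : ball P r.+1 a x <->
  fanset a (fun c => adj a c /\ P c) (ball (fun y => P y /\ y <> a) r) x.
Proof.
split=> [[p [ap lp sp Pp]]|].
  case/shortenP: ap lp => p' ap' up' sub lp.
  case: p' ap' up' sub lp => [|c p'] /=; first by left.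
  case/andP => ac cp /andP[acp up'] sub lp; right; exists c.
    by split=> //; apply/Pp/sub; rewrite inE eqxx.
  exists p'; split=> //.
    exact: leq_trans (uniq_leq_size (up' : uniq (c :: p')) sub) sp.
  move=> y yp; split; first by apply/Pp/sub; rewrite inE yp orbT.
  by move=> ya; case/negP: acp; rewrite -ya inE yp orbT.
case=> [->|[c [ac Pc] bc]]; first exact: ball_refl.
rewrite -add1n; apply: ball_trans (ball_adj ac Pc) _.
by apply: ball_le bc => // y [].
Qed.

(** Otherwise a simple path from [c] to [c'] avoiding [a] would close up through [a] to a cycle. *)
Lemma acyclic_branch a c c' r P : acyclic G -> adj a c -> adj a c' ->
  ~ P a -> P c -> ball P r c c' -> c = c'.
Proof.
move=> ac ca ca' Pa Pc [p [cp + _ Pp]].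
case/shortenP: cp => p' cp' up' sub lp; apply: contrapT => cc'.
have ap : a \notin c :: p'.
  apply/negP; rewrite inE => /orP[/eqP ea|/sub /Pp //].
  by apply: Pa; rewrite ea.
have /negP[] : ~~ cycle (@adj G) (a :: c :: p').
  by apply: ac; [rewrite /= ap|case: (p') lp].
by rewrite /= rcons_path ca cp' lp adj_sym ca'.
Qed.

(** If two branches met or were adjacent, their tops would be joined by a walk avoiding [a],
    contrary to [acyclic_branch]. *)
Lemma fan_ball P r a : acyclic G ->
  fan a (fun c => adj a c /\ P c) (ball (fun y => P y /\ y <> a) r).
Proof.
move=> ac; set P' := fun y => P y /\ y <> a.
have nP' : ~ P' a by case.
have P'C c : adj a c /\ P c -> P' c.
  by case=> aa Pc; split=> // e; rewrite e adj_irr in aa.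
split.
- by move=> c [? ?]; split=> //; apply: ball_refl.
- move=> c x Cc bx; have P'x := ball_in (P'C _ Cc) bx.
  split=> [e|ax]; first by apply: nP'; rewrite -e.
  by apply/esym/(acyclic_branch ac _ ax nP' (P'C _ Cc) bx); case: Cc.
move=> c c' Cc Cc' cc' x y bx by_.
have P'x := ball_in (P'C _ Cc) bx; have P'y := ball_in (P'C _ Cc') by_.
have yc' := ball_sym (P'C _ Cc') by_.
have aux s : ~ ball P' s x y.
  move=> xy; apply: cc'; have := ball_trans (ball_trans bx xy) yc'.
  by apply: acyclic_branch nP' (P'C _ Cc) => //; [case: Cc|case: Cc'].
split; first by move=> e; apply: (aux 0); rewrite e; apply: ball_refl.
by apply/negP => e; apply: (aux 1); apply: ball_adj.
Qed.
End Ball.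

(** One root and, for each of the [8 ^ (s * s)] keys (three booleans for every pair of indices below
    [s]), at most [q] branches of at most [s] vertices. *)
Fixpoint prune_size q r :=
  if r is r'.+1 then
    let s := prune_size q r' in 1 + 8 ^ (s * s) * q * s
  else 1.

Lemma pick_upto (T : eqType) (A : T -> Prop) q :
  exists l : seq T, [/\ uniq l, forall x, x \in l -> A x, size l <= q
    & size l = q \/ forall x, A x -> x \in l].
Proof.
elim: q => [|q [l [ul Al sl [sq|hl]]]].
- by exists [::]; split=> //; left.
- have [[x Ax xl]|h] := pselect (exists2 x, A x & x \notin l).
    exists (x :: l); split; rewrite /= ?xl ?sq //; last by left.
    by move=> y; rewrite inE => /orP[/eqP->|/Al].
  exists l; split=> //; [by rewrite sq|right=> x Ax].
  by apply: contrapT => /negP xl; apply: h; exists x.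
by exists l; split=> //; [apply: leqW|right].
Qed.

Lemma fresh_elem (T : eqType) (l l' : seq T) : uniq l -> size l' < size l ->
  exists2 x, x \in l & x \notin l'.
Proof.
move=> ul sl; apply: contrapT => h.
have /(uniq_leq_size ul) : {subset l <= l'}.
  by move=> x xl; apply: contrapT => /negP xl'; apply: h; exists x.
by rewrite leqNgt sl.
Qed.

(* Up to [q]-equivalence a subtree is determined by a key ranging over a finite
   set, and keeping [q] subtrees for every key suffices. *)
Lemma prune (G : graph) q r (P : G -> Prop) (a : G) : acyclic G ->
  exists L : seq G, [/\ a \in L, size L <= prune_size q r,
    forall x, x \in L -> ball P r a x
    & ef q (ball P r a) (fun x => x \in L) (pt a a)].
Proof.
move=> ac; elim: r P a => [|r IH] P a.
  exists [:: a]; split; rewrite ?inE //.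
    by move=> x; rewrite inE => /eqP->; apply: ball_refl.
  have h x : ball P 0 a x <-> x = a.
    by split=> [[[|c p] [_ <-]]|->] //; apply: ball_refl.
  apply: ef_iso => [u v u' v' [-> ->] [-> ->]//|x /h ->|x].
    by exists a; rewrite inE eqxx.
  by rewrite inE => /eqP->; exists a; split=> //; apply/h.
set s := prune_size q r in IH *.
pose P' y := P y /\ y <> a; pose C c := adj a c /\ P c.
have [L HL] := choice (IH P').
(* Beyond its end the list [L c] is padded with [c], itself a member, so all pruned branches are
   enumerated by the same index set. *)
pose f c (i : 'I_s) := nth c (L c) i.
have fL c i : f c i \in L c.
  have [cL _ _ _] := HL c; rewrite /f.
  by case: (ltnP i (size (L c))) => h; [rewrite mem_nth|rewrite nth_default].
have Lf c x : x \in L c -> exists i, f c i = x.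
  have [_ sL _ _] := HL c => xL.
  have hi : index x (L c) < s by rewrite (leq_trans _ sL) // index_mem.
  by exists (Ordinal hi); rewrite /f nth_index.
(* A key records which indices give equal vertices, which give adjacent ones, and which give the
   top. Branches with equal keys are isomorphic by an isomorphism that respects the tops. *)
pose Key := {ffun 'I_s * 'I_s -> bool * bool * bool}.
pose key c : Key := [ffun p =>
  (f c p.1 == f c p.2, adj (f c p.1) (f c p.2), f c p.1 == c)].
have key_ef c d k : key c = key d ->
    ef k (fun x => x \in L c) (fun x => x \in L d) (pt c d).
  move=> /ffunP e.
  have eqf i j : [/\ (f c i == f c j) = (f d i == f d j),
      adj (f c i) (f c j) = adj (f d i) (f d j) & (f c i == c) = (f d i == d)].
    by have := e (i, j); rewrite !ffunE /= => -[].
  have [cL _ _ _] := HL c; have [i ic] := Lf _ _ cL.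
  apply: (@ef_anti _ _ _ _ _ _ (fun x y => exists j, f c j = x /\ f d j = y)).
    move=> x y [-> ->]; exists i; split=> //.
    by have [_ _] := eqf i i; rewrite ic eqxx => /esym /eqP.
  apply: ef_iso.
  - move=> x y x' y' [j [<- <-]] [j' [<- <-]]; have [e1 e2 _] := eqf j j'.
    by split=> //; split=> /eqP; [rewrite e1|rewrite -e1] => /eqP.
  - by move=> x /Lf[j <-]; exists (f d j); split=> //; exists j.
  by move=> y /Lf[j <-]; exists (f c j); split=> //; exists j.
have [l Hl] := choice (fun k : Key => pick_upto (fun c => C c /\ key c = k) q).
pose D d := d \in l (key d).
pose Ds := flatten [seq l k | k <- enum {: Key}].
have DsP d : d \in Ds <-> D d.
  split=> [/flattenP[_ /mapP[k _ ->] dk]|dD].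
    have [_ /(_ _ dk)[_ e] _ _] := Hl k; by rewrite /D e.
  by apply/flattenP; exists (l (key d)) => //; apply: map_f; rewrite mem_enum.
have DC d : D d -> C d by move=> dD; have [_ /(_ _ dD)[]] := Hl (key d).
have keyl k d : d \in l k -> key d = k.
  by move=> dk; have [_ /(_ _ dk)[]] := Hl k.
pose LL := a :: flatten [seq L d | d <- Ds].
have fanC := fan_ball P r a ac.
have fanD : fan a D (fun d x => x \in L d).
  have [h1 h2 h3] := fanC.
  have LP d x : x \in L d -> ball P' r d x by case: (HL d) => _ _ h _ /h.
  split.
  - by move=> c /DC Cc; have [_ ?] := h1 _ Cc; split=> //; case: (HL c).
  - by move=> c x /DC Cc /LP; apply: h2.
  by move=> c c' /DC Cc /DC Cc' cc' x y /LP px /LP py; apply: (h3 c c').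
pose Match c d := [/\ C c, d \in l (key c) & size (l (key c)) <> q -> c = d].
have LLE x : x \in LL <-> fanset a D (fun d x => x \in L d) x.
  rewrite /LL inE; split.
    case/orP => [/eqP->|/flattenP[_ /mapP[d /DsP Dd ->] xd]]; first by left.
    by right; exists d.
  case=> [->|[d /DsP Dd xd]]; first by rewrite eqxx.
  by apply/orP; right; apply/flattenP; exists (L d) => //; apply: map_f.
have efLL : ef q (ball P r.+1 a) (fun x => x \in LL) (pt a a).
  apply: (@ef_eq _ _ _ (fanset a C (ball P' r)) _
           (fanset a D (fun d x => x \in L d))).
  - by move=> x; rewrite ballS.
  - by move=> x; rewrite LLE.
  apply: (@ef_fan _ _ _ _ _ _ _ _ _ Match fanC fanD).
  - by move=> c d [].
  - by move=> c d [_ dl _]; rewrite /D (keyl _ _ dl).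
  - move=> c d [Cc dl _]; have [_ _ _ e1] := HL c.
    apply: ef_anti (ef_comp e1 (key_ef c d q _)) => [x y [-> ->]|].
      by exists c.
    by rewrite (keyl _ _ dl).
  - move=> t [u1 u2 mt] st c Cc ct.
    have [ul _ _ h] := Hl (key c).
    have [sl|sl] := pselect (size (l (key c)) = q).
      have [d dl dt] : exists2 d, d \in l (key c) & d \notin unzip2 t.
        by apply: fresh_elem; rewrite // size_map sl.
      by exists d.
    case: h => [//|/(_ c (conj Cc erefl)) cl]; exists c => //.
    apply: contra ct => /mapP[[c' c''] ct' /= e]; subst c''.
    have [_ cl' h] := mt _ _ ct'; have ec := keyl _ _ cl'.
    rewrite -{1}(h _); first by apply/mapP; exists (c', c).
    by rewrite -ec.
  move=> t [u1 u2 mt] st d Dd dt.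
  have [ul hl _ _] := Hl (key d).
  have [sl|sl] := pselect (size (l (key d)) = q).
    have [c cl ct] : exists2 c, c \in l (key d) & c \notin unzip1 t.
      by apply: fresh_elem; rewrite // size_map sl.
    exists c => //; have [Cc ek] := hl _ cl.
    by split; rewrite ?ek.
  exists d; first by split=> //; apply: DC.
  apply: contra dt => /mapP[[d' d''] ct' /= e]; subst d'.
  have [_ _ h] := mt _ _ ct'; rewrite (h sl).
  by apply/mapP; exists (d, d'').
exists LL; split=> //; first by rewrite /LL inE eqxx.
  rewrite /= -/s /LL /= add1n ltnS.
  have hs (T : eqType) (ts : seq T) (g : T -> seq G) m :
      (forall t, size (g t) <= m) ->
      size (flatten [seq g t | t <- ts]) <= size ts * m.
    move=> hg; elim: ts => //= t ts IHt.
    by rewrite size_cat mulSn leq_add.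
  have sD : size Ds <= 8 ^ (s * s) * q.
    apply: leq_trans (hs _ _ _ q _) _ => [k|]; first by have [] := Hl k.
    by rewrite -cardE card_ffun !card_prod !card_bool !card_ord.
  apply: leq_trans (hs _ _ _ s _) _ => [d|]; first by have [] := HL d.
  by rewrite leq_mul2r sD orbT.
move=> x /LLE [->|[d Dd xd]]; first exact: ball_refl.
apply/ballS; right; exists d; first exact: DC.
by have [_ _ h _] := HL d; apply: h.
Qed.

(** * The strategy between two rich forests *)

Notation Ball := (ball (fun=> True)).

Lemma ball_trace (M N : graph) k (P : M -> Prop) (Q : N -> Prop) Z a b u v r :
  ef k P Q Z -> Z a b -> Z u v -> r <= k -> (forall z, Ball r a z -> P z) ->
  Ball r a u -> Ball r b v.
Proof.
move=> e zab zuv rk hP [p [ap lp sp _]].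
have [|p' [bp' lp' sp' _]] :=
    ef_trace (p := p) e zab zuv ap lp _ (leq_trans sp rk).
  move=> y yp; apply: hP; case/splitPr: yp ap sp => p1 p2.
  rewrite cat_path /= => /and3P[ap1 l1 _] sp; exists (rcons p1 y); split=> //.
  - by rewrite rcons_path ap1.
  - by rewrite last_rcons.
  by apply: leq_trans sp; rewrite size_rcons size_cat /= addnS ltnS leq_addr.
by exists p'; split=> //; rewrite sp'.
Qed.

Lemma noout_ball (G : graph) (A : G -> Prop) r a x :
  noout A -> A a -> Ball r a x -> A x.
Proof.
move=> no Aa [p [+ <- _ _]]; elim: p a Aa => //= y p IH a Aa /andP[ay].
by apply: IH; apply: no ay.
Qed.

Definition near (G : graph) (s : seq G) r x := exists2 a, a \in s & Ball r a x.

Definition Zseq (M N : graph) (l : seq (M * N)) x y := (x, y) \in l.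

Lemma near_trace (M N : graph) k (P : M -> Prop) (Q : N -> Prop) Z
    (l : seq (M * N)) u v r :
  ef k P Q Z -> (forall x y, Zseq l x y -> Z x y) -> Z u v -> r <= k ->
  (forall z, near (unzip1 l) r z -> P z) ->
  near (unzip1 l) r u -> near (unzip2 l) r v.
Proof.
move=> e sub zuv rk hP [a al au]; have [[a' b] /= ab ea] := mapP al; subst a'.
exists b; first by apply/mapP; exists (a, b).
apply: (ball_trace e (sub _ _ ab) zuv rk _ au) => z az.
by apply: hP; exists a.
Qed.

Definition swap_seq (M N : graph) (l : seq (M * N)) : seq (N * M) :=
  [seq (p.2, p.1) | p <- l].

Lemma unzip1_swap (M N : graph) (l : seq (M * N)) :
  unzip1 (swap_seq l) = unzip2 l.
Proof. by rewrite /unzip1 /swap_seq -map_comp. Qed.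

Lemma unzip2_swap (M N : graph) (l : seq (M * N)) :
  unzip2 (swap_seq l) = unzip1 l.
Proof. by rewrite /unzip2 /swap_seq -map_comp. Qed.

Lemma Zseq_swap (M N : graph) (l : seq (M * N)) x y :
  Zseq (swap_seq l) y x = Zseq l x y.
Proof.
apply/mapP/idP => [[[u v] uv [-> ->]]|xy] //.
by exists (x, y).
Qed.

(** The [r] surplus rounds trace a walk of length at most [r] from a chosen point, which tells
    whether a point lies in the smaller neighbourhoods. *)
Lemma ef_near_restrict (M N : graph) k (P : M -> Prop) (Q : N -> Prop)
    (l : seq (M * N)) r :
  (forall z, near (unzip1 l) r z -> P z) ->
  (forall z, near (unzip2 l) r z -> Q z) ->
  ef (k + r) P Q (Zseq l) -> ef k (near (unzip1 l) r) (near (unzip2 l) r) (Zseq l).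
Proof.
move=> hP hQ; apply: ef_restrict => // Z' u v sub e zuv; split.
  exact: near_trace e sub zuv (leqnn r) hP.
have := @near_trace _ _ _ _ _ _ (swap_seq l) v u r (ef_sym e).
rewrite unzip1_swap unzip2_swap; apply=> // x y; rewrite Zseq_swap; exact: sub.
Qed.

Lemma near_cons (G : graph) (a : G) s r z :
  near (a :: s) r z <-> Ball r a z \/ near s r z.
Proof.
split=> [[b]|[bz|[b bs bz]]].
- by rewrite inE => /orP[/eqP->|bs bz]; [left|right; exists b].
- by exists a; rewrite ?inE ?eqxx.
by exists b; rewrite ?inE ?bs ?orbT.
Qed.

Lemma Ball_le (G : graph) r s (a x : G) : r <= s -> Ball r a x -> Ball s a x.
Proof. by move=> rs; apply: ball_le. Qed.

Lemma ef_step (M N : graph) n k (l : seq (M * N)) (x : M) :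
  Kgraph n M ->
  rich n N (prune_size (3 * 4 ^ k) (4 ^ k) * (size l).+1) ->
  ef (2 * 4 ^ k.+1) (near (unzip1 l) (4 ^ k.+1)) (near (unzip2 l) (4 ^ k.+1))
    (Zseq l) ->
  exists y, ef (2 * 4 ^ k) (near (x :: unzip1 l) (4 ^ k))
    (near (y :: unzip2 l) (4 ^ k)) (Zseq ((x, y) :: l)).
Proof.
move=> KM richN; rewrite expnS; set r := 4 ^ k => e.
have r0 : 0 < r by rewrite expn_gt0.
have nearE (G : graph) (s : seq G) z : near s r z -> near s (4 * r) z.
  by move=> [a al az]; exists a => //; apply: Ball_le az; lia.
have [[a al ax]|far] := pselect (near (unzip1 l) (2 * r + 1) x).
  have [[a' b] /= ab ea] := mapP al; subst a'.
  have bl : b \in unzip2 l by apply/mapP; exists (a, b).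
  (* One round answers [x], [2 * r] are to be kept, and [r] are spent in [ef_near_restrict]. They
     also suffice to trace the distance [2 * r + 1] from [a] to [x], since [r] is positive. *)
  have e1 : ef (2 * r + r).+1 (near (unzip1 l) (4 * r)) (near (unzip2 l) (4 * r))
      (Zseq l) by apply: ef_le e; lia.
  have [f _] := efS e1.
  have [|y [yn e2]] := f x.
    by exists a => //; apply: Ball_le ax; lia.
  have by_ : Ball (2 * r + 1) b y.
    apply: (ball_trace e2 _ _ _ _ ax); [by left|by right|lia|].
    by move=> z az; exists a => //; apply: Ball_le az; lia.
  exists y; apply: (@ef_near_restrict _ _ _ _ _ ((x, y) :: l) r _ _
    (ef_anti _ e2)).
  - move=> z /near_cons[xz|nz]; last exact: nearE.
    exists a => //.
    by apply: Ball_le (ball_trans ax xz); lia.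
  - move=> z /near_cons[yz|nz]; last exact: nearE.
    exists b => //.
    by apply: Ball_le (ball_trans by_ yz); lia.
  move=> u v; rewrite /Zseq inE.
  by case/orP => [/eqP[-> ->]|]; [right|left].
have [L [xL sL LB eL]] := prune (3 * r) r (fun=> True) x (proj1 KM).
(* There is one more copy than chosen points, so some copy contains none of them. *)
pose A := induced [fset z in L]; pose m := (size l).+1.
have KA : K n (copies A m).
  by apply/K_Kgraph; apply: Kgraph_copies; apply: (@Kgraph_induced n M).
have cA : #|copies A m| <= prune_size (3 * r) r * m.
  rewrite card_prod card_ord leq_mul2r -cardfE; apply/orP; right.
  apply: leq_trans sL; apply: leq_trans (size_undup L).
  apply: uniq_leq_size; first exact: fset_uniq.
  by move=> z; rewrite mem_undup inE.
have [f [finj fadj fno]] := richN _ KA cA.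
have [i hi] : exists i : 'I_m, forall u, f (u, i) \notin unzip2 l.
  apply: contrapT => h.
  have /choice [g hg] : forall i : 'I_m, exists u, f (u, i) \in unzip2 l.
    move=> i; apply: contrapT => hu; apply: h; exists i => u.
    by apply/negP => fu; apply: hu; exists u.
  have ug : uniq [seq f (g i, i) | i : 'I_m].
    by apply/injectiveP => u v /finj[].
  have : {subset [seq f (g i, i) | i : 'I_m] <= unzip2 l}.
    by move=> _ /codomP[i ->].
  by move/(uniq_leq_size ug); rewrite size_map -cardE card_ord size_map ltnn.
have xA : x \in [fset z in L] by rewrite inE.
pose y := f ([` xA], i); pose Im v := exists u, v = f (u, i).
have noIm : noout Im.
  move=> _ w [u ->] /[dup] /fno[[u' j] ->]; rewrite fadj => /andP[/eqP/= <- _].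
  by exists u'.
have yIm : Im y by exists [` xA].
have e3 : ef (2 * r + r) (Ball r x) Im (pt x y).
  have e2 : ef (2 * r + r) (fun z => z \in L) Im
      (fun z v => exists2 u : A, z = val u & v = f (u, i)).
    apply: ef_iso.
    - move=> _ _ _ _ [u -> ->] [u' -> ->]; rewrite fadj /= /copies_adj eqxx.
      by split=> //; split=> [/val_inj->//|/finj[->]].
    - move=> z zL; have zA : z \in [fset z in L] by rewrite inE.
      by exists (f ([` zA], i)); split; [exists [` zA]|exists [` zA]].
    move=> _ [u ->]; exists (val u); split; last by exists u.
    by have := valP u; rewrite inE.
  have eL' : ef (2 * r + r) (Ball r x) (fun z => z \in L) (pt x x).
    by apply: ef_le eL; lia.
  apply: ef_anti (ef_comp eL' e2) => u v [-> ->]; exists x => //.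
  by exists [` xA].
(* The [r] surplus rounds asked of [prune] single out the points of the copy that lie in the
   [r]-ball of [y]. *)
have e4 : ef (2 * r) (Ball r x) (Ball r y) (pt x y).
  apply: ef_restrict e3 => // [v|Z' u v sub e3 zuv]; first exact: noout_ball.
  have zxy : Z' x y by apply: sub.
  split; first exact: ball_trace e3 zxy zuv _ _.
  apply: ball_trace (ef_sym e3) zxy zuv _ _ => // z.
  exact: noout_ball.
have e5 : ef (2 * r) (near (unzip1 l) r) (near (unzip2 l) r) (Zseq l).
  by apply: ef_near_restrict; [exact: nearE|exact: nearE|apply: ef_le e; lia].
(* Two [r]-balls that met or were joined by an edge would put [x] within [2 * r + 1] of a chosen
   point. *)
have sepM : separated (near (unzip1 l) r) (Ball r x).
  move=> u v [a al au] xv; have vx := ball_sym I xv.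
  have aux : ~ Ball 1 u v.
    move=> uv; apply: far; exists a => //.
    by apply: Ball_le (ball_trans (ball_trans au uv) vx); lia.
  split; first by move=> uv; apply: aux; rewrite uv; apply: ball_refl.
  by apply/negP => uv; apply: aux; apply: ball_adj.
(* No edge leaves the copy and it contains no chosen point, so it lies apart from the balls of all
   of them. *)
have sepN : separated (near (unzip2 l) r) (Ball r y).
  move=> u v [b bl bu] yv; have ub := ball_sym I bu.
  have vIm := noout_ball noIm yIm yv.
  have aux : ~ Im u.
    by move=> uI; have [w bw] := noout_ball noIm uI ub; case/negP: (hi w); rewrite -bw.
  split; first by move=> uv; apply: aux; rewrite uv.
  by apply/negP => uv; apply: aux; apply: noIm vIm _; rewrite adj_sym.
exists y; apply: ef_anti (ef_eq _ _ (ef_union sepM sepN _ _ e5 e4)).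
- move=> u v; rewrite /Zseq inE => /orP[/eqP[-> ->]|uv]; [by right|by left].
- by move=> z; rewrite near_cons or_comm.
- by move=> z; rewrite near_cons or_comm.
- move=> u v uv; split; [exists u|exists v]; try exact: ball_refl.
    by apply/mapP; exists (u, v).
  by apply/mapP; exists (u, v).
by move=> u v [-> ->]; split; apply: ball_refl.
Qed.

(* [q] copies of a pruned ball fit, so that one of them avoids the points chosen
   so far. *)
Definition game_size q :=
  (q * \sum_(k < q) prune_size (3 * 4 ^ k) (4 ^ k)).+1.

Lemma rich_le n (G : graph) s s' : s <= s' -> rich n G s' -> rich n G s.
Proof. by move=> ss h A KA cA; apply: h KA (leq_trans cA ss). Qed.

(** As [k + size l <= q], every move needs at most [q] copies of a pruned ball, and the sum in
    [game_size] dominates the size for each [k]. *)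
Lemma ef_game (M N : graph) n q k (l : seq (M * N)) :
  Kgraph n M -> Kgraph n N -> rich n M (game_size q) -> rich n N (game_size q) ->
  k + size l <= q ->
  ef (2 * 4 ^ k) (near (unzip1 l) (4 ^ k)) (near (unzip2 l) (4 ^ k)) (Zseq l) ->
  ef k (fun=> True) (fun=> True) (Zseq l).
Proof.
move=> KM KN rM rN; elim: k l => [|k IH] l kq e.
  by split=> //; apply: ef_piso e.
have le_size : prune_size (3 * 4 ^ k) (4 ^ k) * (size l).+1 <= game_size q.
  have kq' : k < q by lia.
  rewrite /game_size (bigD1 (Ordinal kq')) //= mulnDr.
  apply: leqW; apply: leq_trans (leq_addr _ _); rewrite mulnC.
  by rewrite leq_mul //; apply: leq_trans kq; rewrite addSn ltnS leq_addl.
split; first exact: ef_piso e.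
have ext_seq x y : ef k (fun=> True) (fun=> True) (Zseq ((x, y) :: l)) ->
    ef k (fun=> True) (fun=> True) (ext (Zseq l) x y).
  apply: ef_anti => u v [uv|[-> ->]]; first by rewrite /Zseq inE [_ \in l]uv orbT.
  by rewrite /Zseq inE eqxx.
split=> [x _|y _].
  have [y ey] := ef_step x KM (rich_le le_size rN) e.
  exists y; split=> //; apply/ext_seq/IH => //.
  by move: kq; rewrite /= addnS addSn.
(* A move in [N] is answered by the same step with the two graphs exchanged. *)
have [||x] := @ef_step N M n k (swap_seq l) y KN.
- by rewrite size_map; apply: rich_le rM.
- rewrite unzip1_swap unzip2_swap.
  by apply: ef_anti (ef_sym e) => u v; rewrite Zseq_swap.
rewrite unzip1_swap unzip2_swap => ex.
exists x; split=> //; apply/ext_seq/IH; first by move: kq; rewrite /= addnS addSn.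
apply: ef_anti (ef_sym ex) => u v; rewrite /Zseq !inE.
case/orP => [/eqP[-> ->]|uv]; first by rewrite eqxx.
by rewrite -[_ \in _]/(Zseq (swap_seq l) v u) Zseq_swap [Zseq _ _ _]uv orbT.
Qed.

Lemma rich_equiv (M N : graph) n (p : sentence) q :
  Kgraph n M -> Kgraph n N -> qr p <= q ->
  rich n M (game_size q) -> rich n N (game_size q) -> models M p <-> models N p.
Proof.
move=> KM KN pq rM rN; apply: (ef_models pq).
apply: ef_anti (@ef_game M N n q q [::] KM KN rM rN _ _) => //.
  by rewrite addn0.
by apply: ef_iso => // x [].
Qed.

(** * The finite universal forests *)

Definition digit s g i := (g %/ s ^ i) %% s.

(* The forest on [{0, ..., s-1}] in which the parent of [i] is the [i]-th
   base-[s] digit of [g], if smaller than [i]; otherwise [i] is a root. *)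
Definition parent_adj s g i j :=
  (j < i) && (digit s g i == j) || (i < j) && (digit s g j == i).

Lemma parent_adj_sym s g i j : parent_adj s g i j = parent_adj s g j i.
Proof. by rewrite /parent_adj orbC. Qed.

Lemma parent_adj_irr s g i : parent_adj s g i i = false.
Proof. by rewrite /parent_adj ltnn. Qed.

Section Parent.
Variables (b : bool) (s g : nat).
(** With [b] false the graph is edgeless; it replaces a forest that violates [theta], so that every
    code [g] yields a graph of the class. *)
Definition parent_rel : rel 'I_s := fun i j => b && parent_adj s g i j.
Fact parent_rel_sym : symmetric parent_rel.
Proof. by move=> i j; rewrite /parent_rel parent_adj_sym. Qed.
Fact parent_rel_irr : irreflexive parent_rel.
Proof. by move=> i; rewrite /parent_rel parent_adj_irr andbF. Qed.
Definition parent_graph := FGraph parent_rel_sym parent_rel_irr.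

(** The largest element of a finite set can be joined, within that set, to its parent only. *)
Lemma parent_acyclic : acyclic parent_graph.
Proof.
apply: thin_acyclic => B /fset0Pn[x0 x0B].
case: (@arg_maxnP 'I_s x0 (fun i => i \in B) val x0B) => x xB xmax.
exists x => //; rewrite leqNgt; apply/negP => d.
have [y yB /andP[xy _]] := degin_ge2 d x.
have [z zB /andP[xz]] := degin_ge2 d y.
have h u : u \in B -> adj (g := parent_graph) x u -> digit s g x = u.
  move=> uB /andP[_ /orP[/andP[_ /eqP//]|/andP[xu _]]].
  by have := leq_trans xu (xmax u uB); rewrite ltnn.
by case/eqP; apply/val_inj/(etrans (esym (h _ zB xz)))/(h _ yB xy).
Qed.
End Parent.

Definition good n s g : bool :=
  `[< models (parent_graph true s g) (theta n) >].

(** Vertex [i] of the forest with code [g] is the number [g * s + i]. Adjacency is arithmetic on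
    [nat], which makes it accessible to [rec_fun]. *)
Definition funiv_adj n s x y :=
  (x %/ s == y %/ s) &&
  (good n s (x %/ s) && parent_adj s (x %/ s) (x %% s) (y %% s)).

Definition funiv_size s := s ^ s * s.

Section Funiv.
Variables n s : nat.
Definition funiv_rel : rel 'I_(funiv_size s) := fun x y => funiv_adj n s x y.
Fact funiv_sym : symmetric funiv_rel.
Proof.
move=> x y; rewrite /funiv_rel /funiv_adj eq_sym parent_adj_sym.
by case: eqP => [->|].
Qed.
Fact funiv_irr : irreflexive funiv_rel.
Proof.
by move=> x; rewrite /funiv_rel /funiv_adj parent_adj_irr !andbF.
Qed.
Definition funiv := FGraph funiv_sym funiv_irr.
End Funiv.

Lemma Kgraph_parent n s g : Kgraph n (parent_graph (good n s g) s g).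
Proof.
split; first exact: parent_acyclic.
case: (boolP (good n s g)) => [/asboolP /models_theta //|_].
by move=> x [|u z] p _ //= _ /andP[].
Qed.

Lemma Kgraph_funiv n s : Kgraph n (funiv n s).
Proof.
case: s => [|s].
  by split=> [[|[x lx] p]|[x lx]] //; rewrite muln0 in lx.
apply: (@Kgraph_sum n (funiv n s.+1) nat (fun x => x %/ s.+1)
   (fun g => parent_graph (good n s.+1 g) s.+1 g)
   (fun g x => inord (x %% s.+1))).
- by move=> x y /andP[/eqP].
- move=> x y exy /(congr1 val) /=; rewrite !inordK ?ltn_mod // => e.
  apply/val_inj/(etrans (divn_eq x s.+1)).
  by rewrite exy e -divn_eq.
- move=> x y; rewrite /= /funiv_rel /funiv_adj => /andP[_].
  by rewrite /parent_rel !inordK ?ltn_mod.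
by move=> g; apply: Kgraph_parent.
Qed.

Lemma digits_exist s (d : nat -> nat) m : (forall i, d i < s) ->
  exists2 g, g < s ^ m & forall i, i < m -> digit s g i = d i.
Proof.
move=> ds; have s0 : 0 < s by apply: leq_ltn_trans (ds 0).
elim: m d ds => [|m IH] d ds; first by exists 0.
have [g gm hg] := IH (d \o succn) (fun i => ds i.+1).
exists (g * s + d 0).
  rewrite expnSr; apply: (@leq_trans (g * s + s)); first by rewrite ltn_add2l.
  by rewrite -mulSnr leq_mul2r gm orbT.
move=> [_|i im]; rewrite /digit.
  by rewrite expn0 divn1 modnMDl modn_small.
by rewrite expnS divnMA divnMDl // (divn_small (ds 0)) addn0; apply: hg.
Qed.

(** Remove a vertex of degree at most 1 and rank it above all the others. The unique neighbour of
    smaller rank, if any, will be the parent. *)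
Lemma thin_rank (G : graph) (B : {fset G}) : thin G ->
  exists h : G -> nat, [/\ {in B &, injective h}, forall x, x \in B -> h x < #|` B|
    & forall x y z, x \in B -> y \in B -> z \in B -> h y < h x -> h z < h x ->
        adj x y -> adj x z -> y = z].
Proof.
move=> th; move: {2}#|` B| (erefl #|` B|) => m.
elim: m B => [|m IH] B cB.
  by exists (fun=> 0); rewrite (cardfs0_eq cB); split.
have B0 : B != fset0 by rewrite -cardfs_gt0 cB.
have [u uB du] := th _ B0.
have cD := cardfsD1 u B; rewrite uB cB in cD.
have [|h [hi hm hp]] := IH (B `\ u); first by lia.
have sub x : x \in B -> x != u -> x \in B `\ u by move=> xB xu; rewrite !inE xu.
have hlt x : x \in B -> x != u -> h x < m.
  by move=> xB xu; have := hm x (sub _ xB xu); lia.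
exists (fun x => if x == u then m else h x); split.
- move=> x y xB yB /=; case: eqVneq => [->|xu]; case: eqVneq => [->|yu] //.
  + by have := hlt y yB yu; lia.
  + by have := hlt x xB xu; lia.
  by apply: hi; apply: sub.
- move=> x xB; rewrite cB; case: eqVneq => // xu; apply: leqW; exact: hlt.
move=> x y z xB yB zB; have [->|xu] := eqVneq x u.
  case: eqVneq => [_|yu]; first by rewrite ltnn.
  case: eqVneq => [_|zu]; first by rewrite ltnn.
  move=> _ _ uy uz; apply/eqP; apply: contraTT du => yz.
  by rewrite -ltnNge; apply: (degin_two yB zB).
case: eqVneq => [_|yu]; first by have := hlt x xB xu; lia.
case: eqVneq => [_|zu]; first by have := hlt x xB xu; lia.
by apply: hp; apply: sub.
Qed.

Lemma K_rank n (A : Defs.fgraph) : K n A ->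
  exists h : A -> nat, [/\ injective h, forall x, h x < #|A|
    & forall x y z, h y < h x -> h z < h x -> adj x y -> adj x z -> y = z].
Proof.
move=> /K_Kgraph[/acyclic_thin th _].
have [h [hi hm hp]] := thin_rank [fset x | x : A] th.
have inA (x : A) : x \in [fset x | x : A] by rewrite in_imfset.
exists h; split.
- by move=> x y; apply: hi.
- move=> x; apply: leq_trans (hm x (inA x)) _.
  by rewrite card_imfset //= -cardE.
by move=> x y z; apply: hp.
Qed.

(** Ranking the vertices of [A] turns it into a parent function, whose code [g] names the block that
    contains [A]; the ranks left over are isolated. *)
Lemma rich_funiv n s : rich n (funiv n s) s.
Proof.
move=> A KA cA; have [h [hi hm hp]] := K_rank KA.
have hs x : h x < s := leq_trans (hm x) cA.
have [x0|noA] := pselect (inhabited A); last first.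
  have no (x : A) : False by apply: noA; exists.
  by exists (fun x => match no x with end); split=> [x|x|x]; case: (no x).
case: x0 => x0; have s0 : 0 < s by apply: leq_ltn_trans (hs x0).
(* The default digit is [i] itself for [i < s]: not being smaller than [i], it marks a root. *)
pose par i := if [pick p : A * A | [&& h p.1 == i, h p.2 < i & adj p.1 p.2]]
  is Some p then h p.2 else i %% s.
have [|g gs hg] := @digits_exist s par s.
  by move=> i; rewrite /par; case: pickP => [p _|_]; rewrite ?hs ?ltn_mod.
have dig i j : j < i -> i < s -> (digit s g i == j) =
    [exists p : A * A, [&& h p.1 == i, h p.2 == j & adj p.1 p.2]].
  move=> ji si; rewrite hg // /par; case: pickP => [p /and3P[/eqP p1 p2 pa]|no].
    apply/eqP/existsP => [e|[[x y] /and3P[/= /eqP hx /eqP hy xy]]].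
      by exists p; rewrite p1 e !eqxx.
    have ex : x = p.1 by apply: hi; rewrite hx.
    by rewrite -hy; congr h; apply: (hp x); rewrite ?hx ?hy // ex.
  rewrite modn_small // gtn_eqF //; apply/esym/negbTE/existsP => -[p].
  case/and3P => p1 /eqP p2 pa; have := no p; rewrite p1 pa p2 ji.
  by [].
have padjP i j : i < s -> j < s -> reflect
    (exists x y : A, [/\ i = h x, j = h y & adj x y]) (parent_adj s g i j).
  move=> si sj; apply: (iffP orP).
    case=> /andP[lt]; rewrite dig // => /existsP[[x y] /and3P[/= /eqP<- /eqP<- a]].
      by exists x, y.
    by exists y, x; split=> //; rewrite fadj_sym.
  move=> [x [y [-> -> xy]]]; case: (ltngtP (h x) (h y)) => lt.
  - right; rewrite dig //; apply/existsP; exists (y, x); rewrite /= !eqxx.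
    by rewrite fadj_sym.
  - by left; rewrite dig //; apply/existsP; exists (x, y); rewrite /= !eqxx.
  by move: xy; rewrite (hi _ _ lt) adj_irr.
(* The block is a sum of [A] (the class [None]) and of isolated vertices (one class for each [i]
   outside the range of [h]). *)
have gg : good n s g.
  apply/asboolP/models_theta.
  pose inv i := odflt x0 [pick x | h x == i].
  have invK x : inv (h x) = x.
    by rewrite /inv; case: pickP => [y /eqP/hi//|/(_ x)]; rewrite eqxx.
  suff [] : Kgraph n (parent_graph true s g) by [].
  pose c (i : parent_graph true s g) := if h (inv i) == i then None else Some i.
  pose H (o : option 'I_s) : graph := if o is None then A else parent_graph false s g.
  pose f (o : option 'I_s) : parent_graph true s g -> H o :=
    match o with None => fun i => inv i | Some _ => fun i => i end.
  apply: (@Kgraph_sum n _ _ c H f).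
  - move=> i j /padjP[]// x [y [ei ej _]].
    by rewrite /c ei ej !invK !eqxx.
  - move=> i j; rewrite /c; case: eqVneq => hh; case: eqVneq => hh' // _.
    by move=> e; apply/val_inj/(etrans (esym hh))/(etrans (congr1 h e)).
  - move=> i j /padjP[]// x [y [ei ej xy]].
    have -> : c i = None by rewrite /c ei invK eqxx.
    by rewrite /f /= ei ej !invK.
  case=> [i|]; last exact/K_Kgraph.
  split; first exact: parent_acyclic.
  by move=> x [|u z] p _ //= _ /andP[].
have fb x : g * s + h x < funiv_size s.
  apply: (@leq_trans (g * s + s)); first by rewrite ltn_add2l.
  by rewrite -mulSnr leq_mul2r gs orbT.
have dv x : (g * s + h x) %/ s = g by rewrite divnMDl // divn_small ?addn0.
have md x : (g * s + h x) %% s = h x by rewrite modnMDl modn_small.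
exists (fun x => Ordinal (fb x)); split.
- by move=> x y /(congr1 val) /= /addnI /hi.
- move=> x y; rewrite /= /funiv_rel /funiv_adj /= !dv !md eqxx gg /=.
  apply/padjP/idP => // [[x' [y' [/hi -> /hi -> //]]]|xy].
  by exists x, y.
move=> x y; rewrite /= /funiv_rel /funiv_adj /= dv md gg /=.
case/andP => /eqP yg /padjP[]//; first by rewrite ltn_mod.
move=> x' [z [_ yz _]]; exists z; apply/val_inj => /=.
by rewrite [LHS](divn_eq y s) -yg yz.
Qed.

(** * Models of the theory *)

(** Classically every type carries a choice structure and every relation is boolean, so the two
    structures are equal and not merely isomorphic. *)
Lemma structure_graph (S : structure) :
  models S sym_ax -> models S irr_ax -> exists G : graph, S = G.
Proof.
case: S => T R; rewrite /models /= => hs hi.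
have sym (x y : T) : R x y -> R y x.
  have := hs x y; rewrite !env_consS !env_cons0.
  exact.
have irr (x : T) : ~ R x x by have := hi x; rewrite !env_cons0.
pose e : rel {classic T} := fun x y => `[< R x y >].
have es : symmetric e by move=> x y; apply/asboolP/asboolP; apply: sym.
have ei : irreflexive e by move=> x; apply/asboolP; apply: irr.
exists (Graph es ei); have -> : R = (fun x y => e x y); last by [].
by apply/funext => x; apply/funext => y; apply/propext; split => /asboolP.
Qed.

Lemma sat_literal (M : structure) k b (p : formula k) (v : 'I_k -> M) :
  sat (literal b p) v <-> (b <-> sat p v).
Proof.
case: b => /=; split=> [h|[h h']]; [by split|exact: h|by split|].
by move/h'.
Qed.

Lemma models_component (A : Defs.fgraph) (G : graph) :
  models G (let x := lshift 0 : 'I_#|A| -> 'I_(#|A| + 0) in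
            exs (FAnd (diag x) (gamma_star x))) <->
  exists f : A -> G, component_embedding f.
Proof.
rewrite /models sat_exs /=; split.
  case=> u [/sat_and hd hg]; exists (u \o enum_rank).
  have {}hd i j : ((enum_val i == enum_val j) <-> u i = u j) /\
      (fadj (enum_val i : A) (enum_val j) <-> adj (u i) (u j)).
    have /sat_and /(_ j isT) /= [] := hd i isT.
    by rewrite !sat_literal /= !env_appl.
  split=> [x y /= e|x y|x y /= xy].
  - have [[_ h] _] := hd (enum_rank x) (enum_rank y).
    by have := h e; rewrite !enum_rankK => /eqP.
  - have [_] := hd (enum_rank x) (enum_rank y).
    by rewrite !enum_rankK /= => h; apply/idP/idP => /h.
  apply: contrapT => hy; have /= := hg y; rewrite !sat_and => h.
  have /= := h _ (enum_rank x) isT.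
  rewrite env_consS env_appl (env_cons0 y); apply=> // i _ /=.
  rewrite env_consS env_appl => e; apply: hy.
  by exists (enum_val i); rewrite /= enum_valK.
case=> f [fi fa fn]; exists (f \o enum_val); split.
  apply/sat_and => i _; apply/sat_and => j _ /=.
  rewrite !sat_literal /= !env_appl /= fa; split=> //.
  by split=> [/eqP-> //|/fi/eqP].
move=> y; rewrite !sat_and => h i _ /=.
rewrite env_consS env_appl (env_cons0 y) /= => /fn[z yz].
have /= := h (enum_rank z) isT.
by rewrite env_consS env_appl (env_cons0 y) /= enum_rankK; apply.
Qed.

Lemma Univ_graphP n (G : graph) :
  is_model G (Univ n) <-> Kgraph n G /\ forall s, rich n G s.
Proof.
split=> [h|[[ac th] r] p].
  split; last first.
    by move=> s A KA _; apply/models_component/h/Univ_component.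
  split; last by apply/models_theta/h/Univ_theta.
  move=> p up p3; have /h /(models_no_cycle _ p3) := Univ_acyclic n p3.
  exact.
case=> [||k k3||A KA].
- by move=> x y; rewrite /= !env_consS !env_cons0 adj_sym.
- by move=> x; rewrite /= !env_cons0 adj_irr.
- by apply/models_no_cycle => // q uq sq; apply: ac; rewrite ?sq.
- exact/models_theta.
by apply/models_component; apply: (r #|A|).
Qed.

Lemma seq_sub_fset (G : graph) (A : {fset G}) (p : seq G) :
  {subset p <= A} -> exists q : seq A, map val q = p.
Proof.
elim: p => [|x p IH] sub; first by exists [::].
have [|q <-] := IH; first by move=> y yp; apply: sub; rewrite inE yp orbT.
have xA : x \in A by apply: sub; rewrite inE eqxx.
by exists ([` xA] :: q).
Qed.

(** A cycle, or a violation of [theta_prop], involves finitely many vertices. *)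
Lemma Kgraph_age n (G : graph) :
  (forall A : {fset G}, Kgraph n (induced A)) -> Kgraph n G.
Proof.
move=> h; split=> [p up p3|x z p uz sz az sp up].
  have [|q e] := @seq_sub_fset G [fset x in p] p; first by move=> x; rewrite inE.
  move: up p3; rewrite -e size_map map_inj_uniq; last exact: val_inj.
  by rewrite cycle_map; apply: (h _).1.
pose A := [fset u in x :: z ++ p].
have xA : x \in A by rewrite !inE eqxx.
have [|z' ez] := @seq_sub_fset G A z.
  by move=> u uz'; rewrite !inE uz' orbT.
have [|p' ep] := @seq_sub_fset G A p.
  by move=> u up'; rewrite !inE up' !orbT.
have -> : x = val [` xA] by [].
have az' : all (adj (val [` xA])) z by [].
move: uz sz az' sp up; rewrite -ez -ep !size_map.
rewrite !map_inj_uniq; try exact: val_inj.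
rewrite all_map path_map; exact: (h _).2.
Qed.

Lemma is_M_rich n (M : graph) : is_M n M ->
  Kgraph n M /\ forall s, rich n M s.
Proof.
move=> hM; have KM : Kgraph n M.
  by apply: Kgraph_age => A; apply/K_Kgraph/(is_M_age hM).
split=> // s A KA _; have [f cf] := is_M_universal hM KA.
by exists f; apply/(closed_embeddingP _ KM.1).
Qed.

(** * A concrete graph satisfying [is_M] *)

Section Limit.
Variable n : nat.

(** The disjoint union of the graphs [funiv n s.+1] over all [s]: each graph of the class occurs in
    all blocks from some [s] on. The successor makes every block nonempty. *)
Definition limit_vertex := {s : nat & 'I_(funiv_size s.+1)}.
Definition limit_adj : rel limit_vertex := fun x y =>
  (tag x == tag y) && funiv_adj n (tag x).+1 (tagged x) (tagged y).
Fact limit_sym : symmetric limit_adj.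
Proof.
move=> [s x] [t y]; rewrite /limit_adj /= eq_sym; case: eqVneq => //= e.
by subst t; apply: (@funiv_sym n s.+1).
Qed.
Fact limit_irr : irreflexive limit_adj.
Proof. by move=> [s x]; rewrite /limit_adj eqxx; apply: (@funiv_irr n s.+1). Qed.
Definition limit := Graph limit_sym limit_irr.

Lemma funiv_size_gt0 s : 0 < funiv_size s.+1.
Proof. by rewrite muln_gt0 expn_gt0. Qed.

Lemma Kgraph_limit : Kgraph n limit.
Proof.
(* The type of the vertex depends on its tag, so it is moved by its number; the default is never
   taken when the tag is [s]. *)
pose f (s : nat) (x : limit) : funiv n s.+1 :=
  insubd (Ordinal (funiv_size_gt0 s)) (nat_of_ord (tagged x)).
apply: (@Kgraph_sum n limit _ (fun x => tag x) (fun s => funiv n s.+1) f).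
- by move=> x y /andP[/eqP].
- move=> [s x] [t y] /= e; subst t => /(congr1 val).
  by rewrite /f !val_insubd /= !ltn_ord => /val_inj ->.
- move=> [s x] [t y] /andP[/= /eqP e a]; subst t.
  by rewrite /= /funiv_rel /f !val_insubd /= !ltn_ord.
by move=> s; apply: Kgraph_funiv.
Qed.

Definition to_limit s (x : funiv n s.+1) : limit :=
  Tagged (fun s => 'I_(funiv_size s.+1)) x.

Lemma limit_embed (A : Defs.fgraph) s : K n A -> #|A| <= s ->
  exists2 f : A -> limit, component_embedding f & forall x, tag (f x) = s.
Proof.
move=> KA As; have [f [fi fa fn]] := rich_funiv KA (leqW As).
exists (@to_limit s \o f) => //; split.
- move=> x y /= e; apply: fi; move/eqP: e; rewrite -tag_eqE /tag_eq /= eqxx.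
  by rewrite tagged_asE => /eqP.
- by move=> x y; rewrite -fa /= /limit_adj eqxx.
move=> x [t y] /andP[/= /eqP e a]; subst t.
by have [z ->] := fn x y a; exists z.
Qed.

(** A closed [A] is a union of components of [B]: keep [g] there, and map the other components by an
    embedding of [B] into a block that [g] does not reach. *)
Lemma limit_extension (B : Defs.fgraph) (A : {fset B}) : K n B ->
  @closed_in B A -> forall g : @induced B A -> limit, closed_embedding g ->
  exists f : B -> limit, closed_embedding f /\ forall a : A, f (val a) = g a.
Proof.
move=> KB clA g /(closed_embeddingP _ Kgraph_limit.1)[gi ga gn].
have noA := closed_in_noout clA.
pose s := #|B| + (\max_(a : A) tag (g a)).+1.
have [h [hi ha hn] hs] : exists2 h : B -> limit, component_embedding h &
    forall x, tag (h x) = s by apply: limit_embed => //; rewrite leq_addr.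
have gs a : tag (g a) < s.
  by apply: leq_trans (leq_addl _ _); rewrite ltnS (leq_bigmax a).
have gh a x : g a <> h x.
  by move=> e; have := gs a; rewrite e hs ltnn.
pose f x := if insub x is Some a then g a else h x.
have fA (x : B) (xA : x \in A) : f x = g [` xA] by rewrite /f insubT.
have fN (x : B) : x \notin A -> f x = h x by move=> xA; rewrite /f insubN.
have adjgh a x : adj (g a) (h x) = false.
  by apply/negP => /gn[z /esym/gh].
exists f; split; last first.
  by move=> a; rewrite (fA _ (valP a)); congr g; apply: val_inj.
apply/(closed_embeddingP _ Kgraph_limit.1); split.
- move=> x y; have [xA|xA] := boolP (x \in A); have [yA|yA] := boolP (y \in A).
  + by rewrite !fA => /gi [].
  + by rewrite fA fN // => /gh.
  + by rewrite fN // fA => /esym /gh.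
  by rewrite !fN // => /hi.
- move=> x y; have [xA|xA] := boolP (x \in A); have [yA|yA] := boolP (y \in A).
  + by rewrite !fA ga.
  + rewrite fA fN // adjgh; apply/esym/negP => xy.
    by case/negP: yA; apply: noA xy.
  + rewrite fN // fA adj_sym adjgh; apply/esym/negP => xy.
    by case/negP: xA; apply: (noA y) => //; rewrite adj_sym.
  by rewrite !fN // ha.
move=> x y; have [xA|xA] := boolP (x \in A).
  by rewrite fA => /gn[z ->]; exists (val z); rewrite (fA _ (valP z)); congr g;
    apply: val_inj.
rewrite fN // => /[dup] /hn[z ->]; rewrite ha => xz; exists z.
rewrite fN //; apply: contra xA => zA; apply: (noA z) => //.
by rewrite adj_sym.
Qed.

Lemma is_M_limit : is_M n limit.
Proof.
split.
- by exists (@choice.pickle limit_vertex); apply: (pcan_inj (@choice.pickleK limit_vertex)).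
- by move=> A; apply/K_Kgraph/Kgraph_induced/Kgraph_limit.
- move=> A KA; have [f cf _] := limit_embed KA (leqnn _).
  by exists f; apply/(closed_embeddingP _ Kgraph_limit.1).
- exact: limit_extension.
(* The members of the chain are the unions of the first [i] blocks, which no edge leaves. *)
pose C i : {fset limit} :=
  \bigcup_(s <- iota 0 i) [fset @to_limit s x | x : 'I_(funiv_size s.+1)].
have CE i (x : limit) : (x \in C i) = (tag x < i).
  apply/bigfcupP/idP => [[s]|xi].
    by rewrite mem_iota andbT => /andP[_ si] /imfsetP[y _ ->].
  exists (tag x); first by rewrite mem_iota xi.
  by apply/imfsetP; exists (tagged x) => //; case: (x).
exists C; split.
- by move=> i; apply/K_Kgraph/Kgraph_induced/Kgraph_limit.
- move=> i; have /(noout_closed_in Kgraph_limit.1) : noout (fun x => x \in C i).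
    by move=> x y; rewrite !CE => xi /andP[/eqP e _]; rewrite -e.
  apply; apply/fsubsetP => x; rewrite !CE; exact: leqW.
by move=> x; exists (tag x).+1; rewrite CE.
Qed.
End Limit.

Lemma Univ_complete n : complete (Univ n).
Proof.
have /Univ_graphP hL := is_M_rich (is_M_limit n).
split; first by exists (limit n).
have key p : models (limit n) p -> entails (Univ n) p.
  move=> Lp S hS.
  have [G eS] := structure_graph (hS _ (Univ_sym n)) (hS _ (Univ_irr n)).
  subst S; have [KG rG] := (Univ_graphP n G).1 hS.
  have [KL rL] := (Univ_graphP n (limit n)).1 hL.
  exact: (rich_equiv KL KG (leqnn _) (rL _) (rG _)).1 Lp.
by move=> p; have [/key|/(key (FNot p))] := pselect (models (limit n) p);
  [left|right].
Qed.

Lemma is_M_funiv n (M : graph) (p : sentence) q : is_M n M -> qr p <= q ->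
  models M p <-> models (funiv n (game_size q)) p.
Proof.
move=> /is_M_rich[KM rM] pq.
by apply: (rich_equiv KM (@Kgraph_funiv n _) pq (rM _)); apply: rich_funiv.
Qed.

Lemma is_M_pseudofinite n (M : graph) : is_M n M -> pseudofinite (Th M).
Proof.
move=> hM p /(is_M_funiv hM (leqnn _)) Fp.
exists 'I_(funiv_size (game_size (qr p))).
exists (fun x y => funiv_rel n x y); split=> //.
by rewrite card_ord funiv_size_gt0.
Qed.

Lemma entails_Th (M : structure) p : entails (Th M) p <-> models M p.
Proof. by split=> [|Mp N]; apply. Qed.

(** * Recursive functions *)

(* Functions of argument lists of arbitrary length; missing arguments are [0]. *)
Definition rec_fun (f : seq nat -> nat) :=
  forall k, recursive (fun v : k.-tuple nat => f v).

Notation "s `_ i" := (nth 0 s i) : nat_scope.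

Lemma recursive_ext k (f g : k.-tuple nat -> nat) :
  f =1 g -> recursive f -> recursive g.
Proof. by move=> /funext ->. Qed.

Lemma rec_ext (f g : seq nat -> nat) : f =1 g -> rec_fun f -> rec_fun g.
Proof. by move=> /funext ->. Qed.

Lemma rec_nth i : rec_fun (fun s => s`_i).
Proof.
move=> k; case: (ltnP i k) => ik.
  by apply: recursive_ext (rec_proj (Ordinal ik)) => v; rewrite (tnth_nth 0).
apply: recursive_ext (@rec_comp k 0 _ (fun i => match notF (valP i) with end)
  rec_zero _) => [v|[]//].
by rewrite nth_default // size_tuple.
Qed.

(** The values of [gs] replace the first [d] arguments, and the rest are passed on as parameters.
    With [gs] empty this skips [d] arguments, as is needed under the bound variables of a recursion
    or a sum. *)
Lemma rec_comp_seq (F : seq nat -> nat) (gs : seq (seq nat -> nat)) d :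
  rec_fun F -> (forall i, i < size gs -> rec_fun (nth (fun=> 0) gs i)) ->
  rec_fun (fun s => F ([seq g s | g <- gs] ++ drop d s)).
Proof.
move=> hF hg k; pose m := size gs + (k - d).
pose h (i : 'I_m) (v : k.-tuple nat) := 
  ([seq (g : seq nat -> nat) (tval v) | g <- gs] ++ drop d v)`_i.
apply: recursive_ext (@rec_comp k m _ h (hF m) _) => [v|i].
  congr F; apply: (@eq_from_nth _ 0).
    by rewrite size_tuple size_cat size_map size_drop size_tuple.
  move=> i; rewrite size_tuple => im.
  by rewrite -(tnth_nth 0 _ (Ordinal im)) tnth_mktuple.
rewrite /h; case: (ltnP i (size gs)) => ig.
  apply: recursive_ext (hg i ig k) => v.
  by rewrite nth_cat size_map ig (nth_map (fun=> 0)).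
apply: recursive_ext (rec_nth (d + (i - size gs)) k) => v.
by rewrite nth_cat size_map ltnNge ig /= nth_drop.
Qed.

Lemma rec_S f : rec_fun f -> rec_fun (fun s => (f s).+1).
Proof.
move=> hf k.
apply: recursive_ext (@rec_comp k 1 _ (fun _ v => f v) rec_succ (fun=> hf k)).
by move=> v; rewrite /thead tnth_mktuple.
Qed.

Lemma rec_const c : rec_fun (fun=> c).
Proof.
elim: c => [|c IH]; last exact: rec_S.
by move=> k; apply: recursive_ext (@rec_comp k 0 _
  (fun i => match notF (valP i) with end) rec_zero _) => [v|[]//].
Qed.

Lemma rec_natrec a (h : nat -> nat -> seq nat -> nat) n :
  rec_fun n -> rec_fun a -> rec_fun (fun t => h t`_0 t`_1 (drop 2 t)) ->
  rec_fun (fun s => nat_rec _ (a s) (fun i x => h i x s) (n s)).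
Proof.
move=> hn ha hh k.
pose f (v : k.+1.-tuple nat) :=
  nat_rec _ (a (behead v)) (fun i x => h i x (behead v)) (thead v).
have hf : recursive f.
  apply: rec_prim (ha k) (hh k.+2) _ _ => [v|i v]; rewrite /f !theadE //=.
  by rewrite drop0.
pose g (i : 'I_k.+1) (v : k.-tuple nat) := (n v :: v)`_i.
apply: recursive_ext (@rec_comp k k.+1 f g hf _) => [v|i].
  have e : [tuple g i v | i < k.+1] = cons_tuple (n v) v.
    apply: eq_from_tnth => i; rewrite tnth_mktuple (tnth_nth 0) //.
  by rewrite e /f theadE.
rewrite /g; case: i => -[|i] ik /=; [exact: hn|exact: rec_nth].
Qed.

Lemma rec_add f g : rec_fun f -> rec_fun g -> rec_fun (fun s => f s + g s).
Proof.
move=> hf hg; apply: rec_ext (rec_natrec (h := fun _ x _ => x.+1) hf hg _).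
  by move=> s /=; elim: (f s) => //= n ->.
exact/rec_S/rec_nth.
Qed.

Lemma rec_mul f g : rec_fun f -> rec_fun g -> rec_fun (fun s => f s * g s).
Proof.
move=> hf hg.
apply: rec_ext (rec_natrec (h := fun _ x s => g s + x) hf (rec_const 0) _).
  by move=> s /=; elim: (f s) => //= n ->.
apply: rec_add; last exact: rec_nth.
exact: (@rec_comp_seq g [::] 2).
Qed.

Lemma rec_pred f : rec_fun f -> rec_fun (fun s => (f s).-1).
Proof.
move=> hf.
apply: rec_ext (rec_natrec (h := fun i _ _ => i) hf (rec_const 0) _).
  by move=> s /=; case: (f s).
exact: rec_nth.
Qed.

Lemma rec_sub f g : rec_fun f -> rec_fun g -> rec_fun (fun s => f s - g s).
Proof.
move=> hf hg; apply: rec_ext (rec_natrec (h := fun _ x _ => x.-1) hg hf _).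
  by move=> s /=; elim: (g s) => [|n /= ->]; rewrite ?subn0 ?subnS.
exact/rec_pred/rec_nth.
Qed.

Lemma rec_exp f g : rec_fun f -> rec_fun g -> rec_fun (fun s => f s ^ g s).
Proof.
move=> hf hg.
apply: rec_ext (rec_natrec (h := fun _ x s => f s * x) hg (rec_const 1) _).
  by move=> s /=; elim: (g s) => //= n ->; rewrite expnS.
apply: rec_mul; last exact: rec_nth.
exact: (@rec_comp_seq f [::] 2).
Qed.

Lemma rec_sum f (g : nat -> seq nat -> nat) :
  rec_fun f -> rec_fun (fun t => g t`_0 (drop 1 t)) ->
  rec_fun (fun s => \sum_(i < f s) g i s).
Proof.
move=> hf hg.
apply: rec_ext (rec_natrec (h := fun i x s => x + g i s) hf (rec_const 0) _).
  by move=> s /=; elim: (f s) => [|n /= ->]; rewrite ?big_ord0 ?big_ord_recr.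
apply: rec_add; first exact: rec_nth.
apply: rec_ext (@rec_comp_seq _ [:: fun t => t`_0] 2 hg _) => [t|[|]//= _].
  by rewrite /= drop0.
exact: rec_nth.
Qed.

Notation rec_bool b := (rec_fun (fun s => nat_of_bool (b s))).

Lemma rec_leq f g : rec_fun f -> rec_fun g -> rec_bool (fun s => f s <= g s).
Proof.
move=> hf hg; apply: rec_ext (rec_sub (rec_const 1) (rec_sub hf hg)) => s.
by rewrite /leq; case: (f s - g s).
Qed.

Lemma rec_and b c : rec_bool b -> rec_bool c -> rec_bool (fun s => b s && c s).
Proof.
by move=> hb hc; apply: rec_ext (rec_mul hb hc) => s; case: (b s); case: (c s).
Qed.

Lemma rec_or b c : rec_bool b -> rec_bool c -> rec_bool (fun s => b s || c s).
Proof.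
move=> hb hc; apply: rec_ext (rec_leq (rec_const 1) (rec_add hb hc)) => s.
by case: (b s); case: (c s).
Qed.

Lemma rec_eqn f g : rec_fun f -> rec_fun g -> rec_bool (fun s => f s == g s).
Proof.
move=> hf hg; apply: rec_ext (rec_and (rec_leq hf hg) (rec_leq hg hf)) => s.
by rewrite eqn_leq.
Qed.

Lemma rec_if b f g : rec_bool b -> rec_fun f -> rec_fun g ->
  rec_fun (fun s => if b s then f s else g s).
Proof.
move=> hb hf hg.
apply: rec_ext (rec_add (rec_mul hb hf) (rec_mul (rec_sub (rec_const 1) hb) hg)).
by move=> s; case: (b s) => /=; lia.
Qed.

Lemma rec_ifb b c d : rec_bool b -> rec_bool c -> rec_bool d ->
  rec_bool (fun s => if b s then c s else d s).
Proof.
by move=> hb hc hd; apply: rec_ext (rec_if hb hc hd) => s; case: (b s).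
Qed.

Lemma sum_ltn m q : \sum_(i < m) (i < q : nat) = minn m q.
Proof.
elim: m => [|m IH]; first by rewrite big_ord0 min0n.
by rewrite big_ord_recr /= IH; case: (ltnP m q); lia.
Qed.

(** The quotient is the number of positive multiples of [g s] up to [f s]; the guard [0 < g s] gives
    0 on division by 0. *)
Lemma rec_div f g : rec_fun f -> rec_fun g -> rec_fun (fun s => f s %/ g s).
Proof.
move=> hf hg; pose h i s : nat := (0 < g s) && (i.+1 * g s <= f s).
apply: rec_ext (rec_sum (g := h) hf _) => [s|].
  rewrite /h; case: (posnP (g s)) => [->|g0]; first by rewrite big1.
  rewrite -(minn_idPr (leq_div (f s) (g s))) -sum_ltn.
  by apply: eq_bigr => i _; rewrite leq_divRL.
have hg' := @rec_comp_seq g [::] 1 hg; have hf' := @rec_comp_seq f [::] 1 hf.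
apply: rec_and; first by apply: rec_leq; [exact: rec_const|exact: hg'].
apply: rec_leq; [apply: rec_mul; [exact/rec_S/rec_nth|exact: hg']|exact: hf'].
Qed.

Lemma rec_mod f g : rec_fun f -> rec_fun g -> rec_fun (fun s => f s %% g s).
Proof.
move=> hf hg; apply: rec_ext (rec_sub hf (rec_mul (rec_div hf hg) hg)) => s.
by rewrite {1}(divn_eq (f s) (g s)) addKn.
Qed.

Lemma rec_digit f g h : rec_fun f -> rec_fun g -> rec_fun h ->
  rec_fun (fun s => digit (f s) (g s) (h s)).
Proof.
by move=> hf hg hh; apply: rec_mod => //; apply: rec_div => //; apply: rec_exp.
Qed.

(** * Evaluation of sentences in finite structures *)

(* [chead] and [ctail] invert [CodeSeq.code (n :: s) = 2 ^ n * (2 code s + 1)]. *)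
Definition chead c := \sum_(i < c) (c %% 2 ^ i.+1 == 0 : nat).
Definition ctail c := c %/ 2 ^ chead c %/ 2.

Lemma code_cons m s : CodeSeq.code (m :: s) = 2 ^ m * (CodeSeq.code s).*2.+1.
Proof. by []. Qed.

Lemma code_head_lt m s : m < CodeSeq.code (m :: s).
Proof.
by rewrite code_cons; apply: leq_trans (ltn_expl m (ltnSn 1)) _; rewrite leq_pmulr.
Qed.

Lemma code_tail_lt m s : CodeSeq.code s < CodeSeq.code (m :: s).
Proof.
rewrite code_cons; have: 0 < 2 ^ m by rewrite expn_gt0.
by case: (2 ^ m) => // k _; rewrite mulSn; lia.
Qed.

(** The sum counts the [i] such that [2 ^ i.+1] divides the code; as its other factor is odd, these
    are the [i < m], and [m] is below the bound of the sum. *)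
Lemma chead_code m s : chead (CodeSeq.code (m :: s)) = m.
Proof.
have lt := code_head_lt m s; rewrite /chead.
rewrite -[RHS](minn_idPr (ltnW lt)) -sum_ltn; apply: eq_bigr => i _; congr nat_of_bool.
rewrite -/(dvdn _ _); move: (nat_of_ord i) => {lt}i; rewrite code_cons; apply/idP/idP => [d|im]; last first.
  by apply: dvdn_mulr; apply: dvdn_exp2l.
rewrite -[i < m](dvdn_Pexp2l _ _ (ltnSn 1)).
by rewrite -(Gauss_dvdl _ (p := (CodeSeq.code s).*2.+1)) // coprimeXl // coprime2n /= odd_double.
Qed.

Lemma ctail_code m s : ctail (CodeSeq.code (m :: s)) = CodeSeq.code s.
Proof.
by rewrite /ctail chead_code code_cons mulKn ?expn_gt0 // divn2 /= uphalf_double.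
Qed.

Definition carg1 c := chead (ctail c).
Definition carg2 c := chead (ctail (ctail c)).

(* A table of truth values is a number whose binary digit at [c * B + e] is the
   value of the formula with number [c] under the assignment [e]; the base-[n]
   digits of [e] are the values of the variables. *)
Definition look X B c e := digit 2 X (c * B + e).

(** The tests follow the tags in [goedel]. Implication of bits is [<=], and [a + n * e] is the
    assignment [e] with [a] put in front as variable 0. *)
Definition eval_step (n B : nat) (A : nat -> nat -> bool) (X c e : nat) : bool :=
  if chead c == 0 then digit n e (carg1 c) == digit n e (carg2 c)
  else if chead c == 1 then A (digit n e (carg1 c)) (digit n e (carg2 c))
  else if chead c == 3 then look X B (carg1 c) e <= look X B (carg2 c) e
  else if chead c == 4 then 0 < look X B (carg1 c) e * look X B (carg2 c) e
  else if chead c == 5 then 0 < look X B (carg1 c) e + look X B (carg2 c) e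
  else if chead c == 6 then n <= \sum_(a < n) look X B (carg1 c) (a + n * e)
  else if chead c == 7 then 0 < \sum_(a < n) look X B (carg1 c) (a + n * e)
  else false.

(** Entries are filled in the order of [c * B + e], hence by increasing formula number, so the
    entries of subformulas are there when needed. Keeping them in one number turns this
    course-of-values recursion into a primitive one. *)
Definition table n B A J : nat :=
  nat_rec _ 0 (fun j X => X + 2 ^ j * eval_step n B A X (j %/ B) (j %% B)) J.

(** The width [n ^ c] has room for assignments to [c] variables; no more than the rank of a
    sentence, hence at most its number [c], are ever in scope. *)
Definition eval n (A : nat -> nat -> bool) c : bool :=
  eval_step n (n ^ c) A (table n (n ^ c) A (c * n ^ c)) c 0.

(** Entry [j] is added with weight [2 ^ j] to a number below [2 ^ j], and all later terms are
    multiples of [2 ^ j.+1]. *)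
Lemma digit_table n B A J j : j < J ->
  digit 2 (table n B A J) j = eval_step n B A (table n B A j) (j %/ B) (j %% B).
Proof.
have lt J' : table n B A J' < 2 ^ J'.
  elim: J' => //= J' IH; rewrite expnS mul2n -addnn -addSn leq_add //.
  by rewrite -[X in _ <= X]muln1 leq_mul2l leq_b1 orbT.
elim: J => // J IH; rewrite ltnS leq_eqVlt => /orP[/eqP->|jJ].
  rewrite /digit /= mulnC addnC divnMDl ?expn_gt0 //.
  by rewrite (divn_small (lt J)) addn0; case: eval_step.
rewrite -IH //= /digit; have -> : 2 ^ J = 2 ^ (J - j).-1 * 2 * 2 ^ j.
  by rewrite -expnSr prednK ?subn_gt0 // -expnD subnK // ltnW.
rewrite addnC mulnAC divnMDl ?expn_gt0 // mulnAC -modnDml modnMl add0n.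
by [].
Qed.

Lemma sum_bool_forall n (b : 'I_n -> bool) :
  n <= \sum_(a < n) b a <-> forall a, b a.
Proof.
rewrite -[X in X <= _]card_ord -sum1_card; split=> h; last first.
  by apply: leq_sum => a _; rewrite h.
move=> a; apply: contraTT h => na; rewrite -ltnNge.
rewrite [X in X < _](bigD1 a) //= [X in _ < X](bigD1 a) //= (negbTE na).
by rewrite add0n add1n ltnS; apply: leq_sum => i _; case: (b i).
Qed.

Lemma sum_bool_exists n (b : 'I_n -> bool) :
  0 < \sum_(a < n) b a <-> exists a, b a.
Proof.
rewrite lt0n sum_nat_eq0 negb_forall; split=> [/existsP[a]|[a ba]].
  by rewrite eqb0 negbK; exists a.
by apply/existsP; exists a; rewrite ba.
Qed.

Section EvalCorrect.
Variables (n : nat) (A : nat -> nat -> bool) (c0 : nat).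
Hypothesis n0 : 0 < n.
Let S := Structure (fun x y : 'I_n => A x y).
Let B := n ^ c0.
Let T := table n B A.

Definition env_of k e : 'I_k -> S := fun i => Ordinal (ltn_pmod (e %/ n ^ i) n0).

Lemma env_of_cons k (a : 'I_n) e : env_cons (a : S) (@env_of k e) = @env_of k.+1 (a + n * e).
Proof.
apply/funext => i; apply/val_inj.
case: (unliftP ord0 i) => [j|] ->; rewrite ?env_consS ?env_cons0 /=.
  rewrite /bump /= add1n expnS divnMA; congr (_ %/ _ %% _).
  by rewrite addnC mulnC divnMDl // divn_small ?addn0.
by rewrite expn0 divn1 mulnC addnC modnMDl modn_small.
Qed.

Lemma look_table c e x e' : x < c -> e' < B ->
  look (T (c * B + e)) B x e' = eval_step n B A (T (x * B + e')) x e'.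
Proof.
move=> xc eB; have B0 : 0 < B by apply: leq_ltn_trans eB.
rewrite /look digit_table.
  by rewrite divnMDl // divn_small // addn0 modnMDl modn_small.
apply: leq_trans (leq_addr _ _); apply: (@leq_trans (x.+1 * B)).
  by rewrite mulSnr ltn_add2l.
by rewrite leq_mul2r xc orbT.
Qed.

Lemma env_lt k (a : 'I_n) e : e < n ^ k -> a + n * e < n ^ k.+1.
Proof.
move=> ek; rewrite expnS; apply: (@leq_trans (n * e.+1)).
  by rewrite mulnS ltn_add2r.
by rewrite leq_mul2l ek orbT.
Qed.

Lemma env_ltB k e : e < n ^ k -> k <= c0 -> e < B.
Proof. by move=> ek kc; apply: leq_trans ek _; rewrite leq_pexp2l. Qed.

Lemma code1_spec t x : let c := CodeSeq.code [:: t; x] in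
  [/\ chead c = t, carg1 c = x & x < c].
Proof.
split; [exact: chead_code|by rewrite /carg1 ctail_code chead_code|].
exact: ltn_trans (code_head_lt x [::]) (code_tail_lt t _).
Qed.

Lemma code2_spec t x y : let c := CodeSeq.code [:: t; x; y] in
  [/\ chead c = t, carg1 c = x, carg2 c = y, x < c & y < c].
Proof.
split; rewrite /carg2 /carg1 ?ctail_code ?chead_code //.
  exact: ltn_trans (code_head_lt x _) (code_tail_lt t _).
apply: ltn_trans (code_tail_lt t _); apply: ltn_trans (code_tail_lt x _).
exact: code_head_lt.
Qed.

(** The bound [k + qr p <= c0] survives passing under a quantifier, so every assignment met stays
    below [B] and rows of the table do not overlap. *)
Lemma eval_stepP k (p : formula k) e : e < n ^ k -> k + qr p <= c0 ->
  eval_step n B A (T (goedel p * B + e)) (goedel p) e <-> sat p (@env_of k e).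
Proof.
elim: p e => {k} [k i j|k i j|k|k p IHp q IHq|k p IHp q IHq|k p IHp q IHq
  |k p IHp|k p IHp] e ek.
- have [h1 h2 h3 _ _] := code2_spec 0 i j.
  rewrite -[goedel _]/(CodeSeq.code [:: 0; val i; val j]) => _.
  rewrite /eval_step h1 h2 h3 /=.
  by split=> [/eqP e1|/(congr1 val) /= /eqP //]; apply/val_inj.
- have [h1 h2 h3 _ _] := code2_spec 1 i j.
  rewrite -[goedel _]/(CodeSeq.code [:: 1; val i; val j]) => _.
  by rewrite /eval_step h1 h2 h3.
- rewrite -[goedel _]/(CodeSeq.code [:: 2]) => _.
  by rewrite /eval_step chead_code.
- have [h1 h2 h3 h4 h5] := code2_spec 3 (goedel p) (goedel q).
  rewrite -[goedel _]/(CodeSeq.code [:: 3; goedel p; goedel q]) => kq.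
  have [kp kq'] : k + qr p <= c0 /\ k + qr q <= c0 by move: kq => /=; lia.
  have eB := env_ltB ek (leq_trans (leq_addr _ _) kq).
  rewrite /eval_step h1 h2 h3 !look_table //=; rewrite -(IHp e ek kp) -(IHq e ek kq').
  by case: eval_step; case: eval_step; split=> // /(_ isT).
- have [h1 h2 h3 h4 h5] := code2_spec 4 (goedel p) (goedel q).
  rewrite -[goedel _]/(CodeSeq.code [:: 4; goedel p; goedel q]) => kq.
  have [kp kq'] : k + qr p <= c0 /\ k + qr q <= c0 by move: kq => /=; lia.
  have eB := env_ltB ek (leq_trans (leq_addr _ _) kq).
  rewrite /eval_step h1 h2 h3 !look_table //=; rewrite -(IHp e ek kp) -(IHq e ek kq').
  by case: eval_step; case: eval_step; split=> // -[].
- have [h1 h2 h3 h4 h5] := code2_spec 5 (goedel p) (goedel q).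
  rewrite -[goedel _]/(CodeSeq.code [:: 5; goedel p; goedel q]) => kq.
  have [kp kq'] : k + qr p <= c0 /\ k + qr q <= c0 by move: kq => /=; lia.
  have eB := env_ltB ek (leq_trans (leq_addr _ _) kq).
  rewrite /eval_step h1 h2 h3 !look_table //=; rewrite -(IHp e ek kp) -(IHq e ek kq').
  by case: eval_step; case: eval_step; split=> //;
    by [case | move=> _; left | move=> _; right].
- have [h1 h2 h3] := code1_spec 6 (goedel p).
  rewrite -[goedel _]/(CodeSeq.code [:: 6; goedel p]) => kq.
  have kp : k.+1 + qr p <= c0 by move: kq => /=; lia.
  have k1 := leq_trans (leq_addr _ _) kp.
  rewrite /eval_step h1 h2 /=.
  rewrite (eq_bigr (fun a : 'I_n => nat_of_bool
    (eval_step n B A (T (goedel p * B + (a + n * e))) (goedel p) (a + n * e)))); last first.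
    by move=> a _; rewrite look_table //; apply: env_ltB k1; apply: env_lt.
  rewrite sum_bool_forall; split=> [h a|h a].
    by rewrite env_of_cons -IHp //; apply: env_lt.
  by rewrite IHp //; [rewrite -env_of_cons|apply: env_lt].
have [h1 h2 h3] := code1_spec 7 (goedel p).
rewrite -[goedel _]/(CodeSeq.code [:: 7; goedel p]) => kq.
have kp : k.+1 + qr p <= c0 by move: kq => /=; lia.
have k1 := leq_trans (leq_addr _ _) kp.
rewrite /eval_step h1 h2 /=.
rewrite (eq_bigr (fun a : 'I_n => nat_of_bool
  (eval_step n B A (T (goedel p * B + (a + n * e))) (goedel p) (a + n * e)))); last first.
  by move=> a _; rewrite look_table //; apply: env_ltB k1; apply: env_lt.
rewrite sum_bool_exists; split=> [[a h]|[a h]]; exists a.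
  by rewrite env_of_cons -IHp //; apply: env_lt.
by rewrite IHp //; [rewrite -env_of_cons|apply: env_lt].
Qed.
End EvalCorrect.

(** This lets the Gödel number stand for the rank, which the decision procedure therefore never
    computes. *)
Lemma qr_goedel k (p : formula k) : qr p <= goedel p.
Proof.
elim: p => {k} // [k p IHp q IHq|k p IHp q IHq|k p IHp q IHq|k p IHp|k p IHp].
- have [_ _ _ h h'] := code2_spec 3 (goedel p) (goedel q).
  by rewrite geq_max; apply/andP; split; [apply: leq_trans IHp (ltnW h)|
    apply: leq_trans IHq (ltnW h')].
- have [_ _ _ h h'] := code2_spec 4 (goedel p) (goedel q).
  by rewrite geq_max; apply/andP; split; [apply: leq_trans IHp (ltnW h)|
    apply: leq_trans IHq (ltnW h')].
- have [_ _ _ h h'] := code2_spec 5 (goedel p) (goedel q).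
  by rewrite geq_max; apply/andP; split; [apply: leq_trans IHp (ltnW h)|
    apply: leq_trans IHq (ltnW h')].
- by have [_ _ h] := code1_spec 6 (goedel p); apply: leq_ltn_trans IHp h.
by have [_ _ h] := code1_spec 7 (goedel p); apply: leq_ltn_trans IHp h.
Qed.

Lemma evalP n A (p : sentence) : 0 < n ->
  eval n A (goedel p) <-> models (Structure (fun x y : 'I_n => A x y)) p.
Proof.
move=> n0.
rewrite -[eval _ _ _]/(eval_step n _ A _ _ 0).
have := @eval_stepP n A (goedel p) n0 0 p 0.
rewrite expn0 addn0 => -> //; last exact: qr_goedel.
rewrite /models; have -> : @env_of n A n0 0 0 = no_var _; last by [].
by apply/funext => -[].
Qed.

Lemma rec_chead f : rec_fun f -> rec_fun (fun s => chead (f s)).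
Proof.
move=> hf; apply: (rec_sum (g := fun i s => (f s %% 2 ^ i.+1 == 0 : nat))) => //.
have hf' := @rec_comp_seq f [::] 1 hf.
apply: rec_eqn; last exact: rec_const.
apply: rec_mod; first exact: hf'.
apply: rec_exp; first exact: rec_const.
exact/rec_S/rec_nth.
Qed.

Lemma rec_ctail f : rec_fun f -> rec_fun (fun s => ctail (f s)).
Proof.
move=> hf; apply: rec_div; last exact: rec_const.
apply: rec_div => //; apply: rec_exp; first exact: rec_const.
exact: rec_chead.
Qed.

Lemma rec_carg1 f : rec_fun f -> rec_fun (fun s => carg1 (f s)).
Proof. by move=> hf; apply/rec_chead/rec_ctail. Qed.

Lemma rec_carg2 f : rec_fun f -> rec_fun (fun s => carg2 (f s)).
Proof. by move=> hf; apply/rec_chead/rec_ctail/rec_ctail. Qed.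

Lemma rec_look f g h k : rec_fun f -> rec_fun g -> rec_fun h -> rec_fun k ->
  rec_fun (fun s => look (f s) (g s) (h s) (k s)).
Proof.
move=> hf hg hh hk; apply: rec_digit => //; first exact: rec_const.
by apply: rec_add => //; apply: rec_mul.
Qed.

Lemma rec_nth_drop d i : rec_fun (fun s => (drop d s)`_i).
Proof. by apply: rec_ext (rec_nth (d + i)) => s; rewrite nth_drop. Qed.

Section EvalRec.
Variable A : nat -> nat -> seq nat -> bool.
Hypothesis recA : rec_bool (fun t => A t`_0 t`_1 (drop 2 t)).

(** The arguments are, in order, the table [X], the formula [c], the assignment [e], the size [n]
    and the width [B]; parameters of [A] follow from position 5 on. *)
Lemma rec_eval_step :
  rec_bool (fun t => eval_step t`_3 t`_4 (fun x y => A x y (drop 5 t)) t`_0 t`_1 t`_2).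
Proof.
have rec_arg i := rec_nth i.
rewrite /eval_step; apply: rec_ifb.
  by apply: rec_eqn; [apply: rec_chead|apply: rec_const].
  by apply: rec_eqn; apply: rec_digit => //; [apply: rec_carg1|apply: rec_carg2].
apply: rec_ifb.
  by apply: rec_eqn; [apply: rec_chead|apply: rec_const].
  apply: rec_ext (@rec_comp_seq _ [:: fun t => digit t`_3 t`_2 (carg1 t`_1);
     fun t => digit t`_3 t`_2 (carg2 t`_1)] 5 recA _) => [t|[|[|]]//= _].
  - by rewrite /= drop0.
  - by apply: rec_digit => //; apply: rec_carg1.
  - by apply: rec_digit => //; apply: rec_carg2.
apply: rec_ifb.
  by apply: rec_eqn; [apply: rec_chead|apply: rec_const].
  by apply: rec_leq; apply: rec_look => //; [apply: rec_carg1|apply: rec_carg2].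
apply: rec_ifb.
  by apply: rec_eqn; [apply: rec_chead|apply: rec_const].
  apply: rec_leq; first exact: rec_const.
  by apply: rec_mul; apply: rec_look => //; [apply: rec_carg1|apply: rec_carg2].
apply: rec_ifb.
  by apply: rec_eqn; [apply: rec_chead|apply: rec_const].
  apply: rec_leq; first exact: rec_const.
  by apply: rec_add; apply: rec_look => //; [apply: rec_carg1|apply: rec_carg2].
have rec_sum_look : rec_fun (fun t =>
    \sum_(a < t`_3) look t`_0 t`_4 (carg1 t`_1) (a + t`_3 * t`_2)).
  apply: (rec_sum (g := fun a t =>
    look t`_0 t`_4 (carg1 t`_1) (a + t`_3 * t`_2))) => //.
  apply: rec_look; [exact: rec_nth_drop|exact: rec_nth_drop| |].
    by apply: rec_carg1; apply: rec_nth_drop.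
  apply: rec_add => //; apply: rec_mul; exact: rec_nth_drop.
apply: rec_ifb.
  by apply: rec_eqn; [apply: rec_chead|apply: rec_const].
  exact: rec_leq.
apply: rec_ifb.
  by apply: rec_eqn; [apply: rec_chead|apply: rec_const].
  by apply: rec_leq => //; apply: rec_const.
exact: rec_const.
Qed.

Lemma rec_table :
  rec_fun (fun t => table t`_1 t`_2 (fun x y => A x y (drop 3 t)) t`_0).
Proof.
rewrite /table; apply: (rec_natrec (a := fun=> 0) (h := fun j X t => X + 2 ^ j *
  eval_step t`_1 t`_2 (fun x y => A x y (drop 3 t)) X (j %/ t`_2) (j %% t`_2))).
- exact: rec_nth.
- exact: rec_const.
apply: rec_add; first exact: rec_nth.
apply: rec_mul; first by apply: rec_exp; [exact: rec_const|exact: rec_nth].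
apply: rec_ext (@rec_comp_seq _ [:: fun t => t`_1; fun t => t`_0 %/ t`_4;
  fun t => t`_0 %% t`_4; fun t => t`_3; fun t => t`_4] 5 rec_eval_step _).
  by move=> t; rewrite /= !nth_drop drop0 drop_drop.
move=> [|[|[|[|[|]]]]] //= _; try exact: rec_nth.
- by apply: rec_div; apply: rec_nth.
- by apply: rec_mod; apply: rec_nth.
Qed.

Lemma rec_eval N : rec_fun N ->
  rec_bool (fun t => eval (N (drop 1 t)) (fun x y => A x y (drop 1 t)) t`_0).
Proof.
move=> hN; have hN1 := @rec_comp_seq N [::] 1 hN.
rewrite /eval.
pose B t := N (drop 1 t) ^ t`_0.
have recB : rec_fun B by apply: rec_exp; [exact: hN1|exact: rec_nth].
pose T t := table (N (drop 1 t)) (B t) (fun x y => A x y (drop 1 t)) (t`_0 * B t).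
have recT : rec_fun T.
  apply: rec_ext (@rec_comp_seq _ [:: fun t => t`_0 * B t;
    fun t => N (drop 1 t); B] 1 rec_table _).
    by move=> t; rewrite /= drop0.
  move=> [|[|[|]]] //= _; last exact: hN1.
  by apply: rec_mul; [exact: rec_nth|exact: recB].
apply: rec_ext (@rec_comp_seq _ [:: T; fun t => t`_0; fun=> 0;
  fun t => N (drop 1 t); B] 1 rec_eval_step _).
  by move=> t; rewrite /= drop0.
move=> [|[|[|[|[|]]]]] //= _.
- exact: rec_nth.
- exact: rec_const.
exact: hN1.
Qed.
End EvalRec.

(** * Recursiveness of the finite universal forests *)

Lemma rec_prune_size f g : rec_fun f -> rec_fun g ->
  rec_fun (fun s => prune_size (f s) (g s)).
Proof.
move=> hf hg; pose h (i x : nat) s := 1 + 8 ^ (x * x) * f s * x.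
apply: rec_ext (rec_natrec (h := h) hg (rec_const 1) _).
  by move=> s; elim: (g s) => //= r ->.
have hf2 := @rec_comp_seq f [::] 2 hf; have x1 := rec_nth 1.
apply: rec_add; first exact: rec_const.
apply: rec_mul => //; apply: rec_mul; last exact: hf2.
by apply: rec_exp; [exact: rec_const|apply: rec_mul].
Qed.

Lemma rec_game_size f : rec_fun f -> rec_fun (fun s => game_size (f s)).
Proof.
move=> hf; apply: rec_S; apply: rec_mul => //.
apply: (rec_sum (g := fun k _ => prune_size (3 * 4 ^ k) (4 ^ k))) => //.
have r4 : rec_fun (fun t => 4 ^ t`_0).
  by apply: rec_exp; [exact: rec_const|exact: rec_nth].
by apply: rec_prune_size => //; apply: rec_mul => //; exact: rec_const.
Qed.

Lemma rec_funiv_size f : rec_fun f -> rec_fun (fun s => funiv_size (f s)).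
Proof. by move=> hf; apply: rec_mul => //; apply: rec_exp. Qed.

Lemma rec_parent_adj f g h k : rec_fun f -> rec_fun g -> rec_fun h ->
  rec_fun k -> rec_bool (fun s => parent_adj (f s) (g s) (h s) (k s)).
Proof.
move=> hf hg hh hk; apply: rec_or; apply: rec_and; try exact: rec_leq (rec_S _) _.
  by apply: rec_eqn => //; apply: rec_digit.
by apply: rec_eqn => //; apply: rec_digit.
Qed.

(** Although [good] is defined classically, it is computed by running the evaluator on [theta n].
    The empty graph is treated apart, since [evalP] requires a vertex. *)
Lemma rec_good n f g : rec_fun f -> rec_fun g ->
  rec_bool (fun s => good n (f s) (g s)).
Proof.
move=> hf hg; pose A x y (u : seq nat) := parent_adj u`_0 u`_1 x y.
have recA : rec_bool (fun t => A t`_0 t`_1 (drop 2 t)).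
  by apply: rec_parent_adj; try exact: rec_nth; exact: rec_nth_drop.
have ev := rec_eval recA (rec_nth 0).
have evfg : rec_bool (fun s => eval (f s) (parent_adj (f s) (g s)) (goedel (theta n))).
  apply: rec_ext (@rec_comp_seq _ [:: fun=> goedel (theta n); f; g] 0 ev _).
    by move=> s.
  by move=> [|[|[|]]] //= _; apply: rec_const.
apply: rec_ext (rec_ifb (rec_eqn hf (rec_const 0)) (rec_const true) evfg) => s.
case: eqVneq => [->|s0]; congr nat_of_bool; apply/esym.
  by apply/asboolP/models_theta => -[].
by rewrite -lt0n in s0; apply/asboolP/idP; rewrite evalP.
Qed.

Lemma rec_funiv_adj n f g h : rec_fun f -> rec_fun g -> rec_fun h ->
  rec_bool (fun s => funiv_adj n (f s) (g s) (h s)).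
Proof.
move=> hf hg hh; have hgf := rec_div hg hf.
apply: rec_and; first by apply: rec_eqn => //; apply: rec_div.
by apply: rec_and; [apply: rec_good|apply: rec_parent_adj => //; apply: rec_mod].
Qed.

Lemma is_M_decidable n (M : graph) : is_M n M -> decidable_theory (Th M).
Proof.
move=> hM; pose A x y (u : seq nat) := funiv_adj n u`_0 x y.
have recA : rec_bool (fun t => A t`_0 t`_1 (drop 2 t)).
  by apply: rec_funiv_adj; try exact: rec_nth; exact: rec_nth_drop.
have ev := rec_eval recA (rec_funiv_size (rec_nth 0)).
(* The number [c] bounds the rank of the sentence it codes, so the finite graph for [c] rounds
   agrees with [M] on that sentence. *)
pose d c : bool := eval (funiv_size (game_size c)) (funiv_adj n (game_size c)) c.
have recd : rec_bool (fun s => d s`_0).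
  apply: rec_ext (@rec_comp_seq _ [:: fun s => s`_0; fun s => game_size s`_0]
    0 ev _); first by move=> s.
  by move=> [|[|]] //= _; [exact: rec_nth|apply: rec_game_size; exact: rec_nth].
exists (fun v => d v`_0); split; first exact: recd.
move=> p; rewrite entails_Th (is_M_funiv hM (qr_goedel p)) /=.
have /= := @evalP (funiv_size (game_size (goedel p)))
  (funiv_adj n (game_size (goedel p))) p (funiv_size_gt0 _).
by rewrite /d => <-; case: eval.
Qed.

Theorem theorem5p4 (n : nat) (hn : 1 <= n) :
  complete (Univ n) /\
  (exists M : graph, is_M n M) /\
  (forall M : graph, is_M n M ->
     decidable_theory (Th M) /\ pseudofinite (Th M)).
Proof.
split; first exact: Univ_complete.
split; first by exists (limit n); apply: is_M_limit.
by move=> M hM; split; [apply: is_M_decidable hM|apply: is_M_pseudofinite hM].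
Qed.
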